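(* The map $ehr^{str}:\mathcal{H}_{\mathbf{qp}}\to\mathbb{K}[X]$, $\lfloor P\rfloor\mapsto ehr^{str}_P(X)$, is the unique map from $\mathcal{H}_{\mathbf{qp}}$ to $\mathbb{K}[X]$ such that: 1. it is a Hopf algebra morphism from $(\mathcal{H}_{\mathbf{qp}},m,\Delta)$ to $(\mathbb{K}[X],m,\Delta)$; 2. it is a bialgebra morphism from $(\mathcal{H}_{\mathbf{qp}},m,\delta)$ to $(\mathbb{K}[X],m,\delta)$. Moreover, the character $\alpha^{str}$ is the inverse of $\lambda$ in the monoid $M_{\mathbf{qp}}$.
   Context: $\mathbb{K}$ is a field of characteristic zero. A quasi-poset is a pair $P=(A,\leq_P)$ with $A$ finite and $\leq_P$ reflexive and transitive; $x\sim_Py$ means $x\leq_Py$ and $y\leq_Px$; $cl(P)$ is the number of $\sim_P$-classes; $\lfloor P\rfloor$ is the isoclass; $P_{\mid B}$ is the restriction to $B\subseteq A$; $top(P)$ is the topology of open sets, i.e. subsets $O$ with ($i\in O$, $i\leq_Pj$)$\Rightarrow j\in O$; $P$ is connected if this topology is connected. $P$ is discrete if $\leq_P$ equals $\sim_P$. For an equivalence $\sim$ on $A$: $x\leq_{P|\sim}y$ iff $x\leq_Py$ and $x\sim y$; $\leq_{P/\sim}$ is the transitive closure of the relation ($x\leq_Py$ or $x\sim y$). These are quasi-posets $P|\sim$ and $P/\sim$ on $A$. We write $\sim\triangleleft P$ if the restriction of $P$ to each class of $\sim$ is connected and $\sim_{P/\sim}$ equals $\sim$. $\mathcal{H}_{\mathbf{qp}}$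 is the $\mathbb{K}$-vector space with basis the set $\mathbf{qp}$ of isoclasses of quasi-posets, with product $m$ given by disjoint union (unit: empty quasi-poset $1$), and coproducts $\Delta(\lfloor P\rfloor)=\sum_{O\in top(P)}\lfloor P_{\mid A\setminus O}\rfloor\otimes\lfloor P_{\mid O}\rfloor$ and $\delta(\lfloor P\rfloor)=\sum_{\sim\triangleleft P}\lfloor P/\sim\rfloor\otimes\lfloor P|\sim\rfloor$. $(\mathcal{H}_{\mathbf{qp}},m,\Delta)$ is a Hopf algebra, graded by $(\mathcal{H}_{\mathbf{qp}})_n=Vect(\lfloor P\rfloor: cl(P)=n)$; $(\mathcal{H}_{\mathbf{qp}},m,\delta)$ is a bialgebra with counit $\varepsilon'$, $\varepsilon'(\lfloor P\rfloor)=1$ if $P$ is discrete and $0$ otherwise. $\mathbb{K}[X]$ has its usual product and grading, and coproducts (algebra morphisms) $\Delta(X)=X\otimes1+1\otimes X$, $\delta(X)=X\otimes X$. $M_{\mathbf{qp}}$ is the monoid of characters (algebra morphisms to $\mathbb{K}$) of $\mathcal{H}_{\mathbf{qp}}$ with product $\lambda*\mu=(\lambda\otimes\mu)\circ\delta$ (identifying $\mathbb{K}\otimes\mathbb{K}=\mathbb{K}$) and unit $\varepsilon'$. For a Hopf algebra morphism $\phi:(\mathcal{H}_{\mathbf{qp}},m,\Delta)\to(\mathbb{K}[X],m,\Delta)$ and $\lambda\in M_{\mathbf{qp}}$, $\phi\leftarrow\lambda=(\phi\otimes\lambda)\circ\delta$. For $k\ge1$, $L^{str}_P(k)$ is the set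 of maps $f:A\to\{1,\ldots,k\}$ such that $i\leq_Pj\Rightarrow f(i)\leq f(j)$ and ($i\leq_Pj$ and $f(i)=f(j)$)$\Rightarrow i\sim_Pj$; $ehr_P^{str}$ is the unique polynomial with $ehr_P^{str}(k)=\sharp L_P^{str}(k)$ for all $k\geq1$. $\phi_0$ is the unique homogeneous Hopf algebra morphism $(\mathcal{H}_{\mathbf{qp}},m,\Delta)\to(\mathbb{K}[X],m,\Delta)$ sending, for every $n\ge1$, the isoclass of the quasi-poset with $n$ pairwise equivalent elements to $X$. $\lambda\in M_{\mathbf{qp}}$ is the unique character with $\phi_0(\lfloor P\rfloor)=\lambda_PX^{cl(P)}$ for all $P$, and $\alpha^{str}\in M_{\mathbf{qp}}$ is the unique character with $ehr^{str}=\phi_0\leftarrow\alpha^{str}$. *)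

(* Defs.v *)
From HB Require Import structures.
From Stdlib Require Import ClassicalEpsilon.
From mathcomp Require Import all_boot all_algebra finmap generic_quotient.
From mathcomp Require Import monalg.

Set Implicit Arguments.
Unset Strict Implicit.
Unset Printing Implicit Defensive.

Import GRing.Theory.

Local Open Scope ring_scope.
Local Open Scope quotient_scope.

Section QuasiPosets.

Definition is_quasi_order (A : finType) (r : {ffun A * A -> bool}) : bool :=
  [forall x, r (x, x)] &&
  [forall x, forall y, forall z, r (x, y) ==> r (y, z) ==> r (x, z)].

Record quasiPoset (A : finType) := QuasiPoset {
  qp_graph : {ffun A * A -> bool};
  _ : is_quasi_order qp_graph }.

HB.instance Definition _ (A : finType) := [isSub for @qp_graph A].
HB.instance Definition _ (A : finType) := [Countable of quasiPoset A by <:].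
HB.instance Definition _ (A : finType) := [Finite of quasiPoset A by <:].

Definition le (A : finType) (P : quasiPoset A) : rel A :=
  fun x y => qp_graph P (x, y).

Fact mkQP_subproof (A : finType) (r : rel A) :
  reflexive r -> transitive r -> is_quasi_order [ffun u => r u.1 u.2].
Proof.
move=> rr rt; apply/andP; split; first by apply/forallP=> x; rewrite ffunE rr.
apply/forallP=> x; apply/forallP=> y; apply/forallP=> z; rewrite !ffunE /=.
by apply/implyP=> xy; apply/implyP=> yz; apply: rt yz.
Qed.

Definition mkQP (A : finType) (r : rel A) (rr : reflexive r)
    (rt : transitive r) : quasiPoset A :=
  QuasiPoset (mkQP_subproof rr rt).

Lemma le_mkQP (A : finType) (r : rel A) (rr : reflexive r)
  (rt : transitive r) : le (mkQP rr rt) =2 r.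
Proof. by move=> x y; rewrite /le ffunE. Qed.

Lemma le_refl (A : finType) (P : quasiPoset A) : reflexive (le P).
Proof.
by move=> x; case: P => r /= rP; case/andP: (rP) => /forallP/(_ x).
Qed.

Lemma le_trans (A : finType) (P : quasiPoset A) : transitive (le P).
Proof.
case: P => r /= rP y x z; case/andP: (rP) => _ /forallP/(_ x)/forallP/(_ y).
by move=> /forallP/(_ z)/implyP h /h /implyP; apply.
Qed.

Definition sim (A : finType) (P : quasiPoset A) : rel A :=
  fun x y => le P x y && le P y x.

Definition cl (A : finType) (P : quasiPoset A) : nat :=
  #|[set [set y | sim P x y] | x : A]|.

Definition discrete (A : finType) (P : quasiPoset A) : bool :=
  [forall x, forall y, le P x y == sim P x y].

(* The quasi-order induced on [B] by a map [f : B -> A]. *)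
Definition pullback (A B : finType) (f : B -> A) (P : quasiPoset A) :
    quasiPoset B :=
  mkQP (r := relpre f (le P)) (fun x => le_refl P (f x))
    (fun y x z => @le_trans A P (f y) (f x) (f z)).

Definition restrict (A : finType) (P : quasiPoset A) (B : {set A}) :
    quasiPoset {x | x \in B} :=
  pullback val P.

Definition opens (A : finType) (P : quasiPoset A) : {set {set A}} :=
  [set O : {set A} |
    [forall i, forall j, (i \in O) && le P i j ==> (j \in O)]].

Definition connected (A : finType) (P : quasiPoset A) : bool :=
  [forall O in opens P,
    (~: O \in opens P) ==> (O == set0) || (O == [set: A])].

(* Equivalence relations on [A] are the symmetric quasi-orders on [A]. *)
Definition is_equiv (A : finType) (E : quasiPoset A) : bool :=
  [forall x, forall y, le E x y == le E y x].

Fact inter_refl (A : finType) (P E : quasiPoset A) :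
  reflexive [rel x y | le P x y && le E x y].
Proof. by move=> x /=; rewrite !le_refl. Qed.

Fact inter_trans (A : finType) (P E : quasiPoset A) :
  transitive [rel x y | le P x y && le E x y].
Proof.
move=> y x z /= /andP[h1 h2] /andP[h3 h4].
by rewrite (le_trans h1 h3) (le_trans h2 h4).
Qed.

(* P | ~ *)
Definition inter (A : finType) (P E : quasiPoset A) : quasiPoset A :=
  mkQP (@inter_refl A P E) (@inter_trans A P E).

(* P / ~ ; [connect] is the reflexive transitive closure. *)
Definition contract (A : finType) (P E : quasiPoset A) : quasiPoset A :=
  mkQP (r := connect [rel x y | le P x y || le E x y]) (@connect0 _ _) (@connect_trans _ _).

(* E <| P *)
Definition compatible (A : finType) (E P : quasiPoset A) : bool :=
  [forall x, connected (restrict P [set y | le E x y])] &&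
  [forall x, forall y, sim (contract P E) x y == le E x y].

Definition qsum_rel (A B : finType) (P : quasiPoset A) (Q : quasiPoset B) :
    rel (A + B) :=
  fun u v => match u, v with
             | inl x, inl y => le P x y
             | inr x, inr y => le Q x y
             | _, _ => false
             end.

Fact qsum_refl (A B : finType) (P : quasiPoset A) (Q : quasiPoset B) :
  reflexive (qsum_rel P Q).
Proof. by case=> x /=; rewrite le_refl. Qed.

Fact qsum_trans (A B : finType) (P : quasiPoset A) (Q : quasiPoset B) :
  transitive (qsum_rel P Q).
Proof. by case=> y [] x [] z //=; apply: le_trans. Qed.

Definition qsum (A B : finType) (P : quasiPoset A) (Q : quasiPoset B) :
    quasiPoset (A + B)%type :=
  mkQP (@qsum_refl A B P Q) (@qsum_trans A B P Q).

Definition indiscrete (A : finType) : quasiPoset A :=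
  mkQP (r := fun _ _ => true) (fun _ => isT) (fun _ _ _ _ _ => isT).

(* Maps to 'I_k = {0, ..., k - 1} instead of {1, ..., k}. *)
Definition Lstr (A : finType) (P : quasiPoset A) (k : nat) :
    {set {ffun A -> 'I_k}} :=
  [set f : {ffun A -> 'I_k} |
    [forall i, forall j, le P i j ==> (f i <= f j)%N] &&
    [forall i, forall j, le P i j && (f i == f j) ==> sim P i j]].

End QuasiPosets.

Section IsoClasses.

Definition isomorphic (A B : finType) (P : quasiPoset A) (Q : quasiPoset B) :
    Prop :=
  exists2 f : A -> B, bijective f & forall x y, le Q (f x) (f y) = le P x y.

Definition isob (A B : finType) (P : quasiPoset A) (Q : quasiPoset B) : bool :=
  [exists f : {ffun A -> B}, [&& injectiveb f, #|A| == #|B| &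
    [forall x, forall y, le Q (f x) (f y) == le P x y]]].

Lemma isobP (A B : finType) (P : quasiPoset A) (Q : quasiPoset B) :
  reflect (isomorphic P Q) (isob P Q).
Proof.
apply: (iffP existsP) => [[f /and3P[/injectiveP fi /eqP c h]]|[f fb h]].
  exists f; first by apply: inj_card_bij => //; rewrite c.
  by move=> x y; move: h => /forallP/(_ x)/forallP/(_ y)/eqP.
exists [ffun x => f x]; apply/and3P; split.
- by apply/injectiveP=> x y; rewrite !ffunE; apply: (bij_inj fb).
- by rewrite (bij_eq_card fb).
- by apply/forallP=> x; apply/forallP=> y; rewrite !ffunE h.
Qed.

Lemma isomorphic_refl (A : finType) (P : quasiPoset A) : isomorphic P P.
Proof. by exists id => //; exists id. Qed.

Lemma isomorphic_sym (A B : finType) (P : quasiPoset A) (Q : quasiPoset B) :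
  isomorphic P Q -> isomorphic Q P.
Proof.
case=> f [g fK gK] h; exists g; first by exists f.
by move=> x y; rewrite -h !gK.
Qed.

Lemma isomorphic_trans (A B C : finType) (P : quasiPoset A)
    (Q : quasiPoset B) (S : quasiPoset C) :
  isomorphic P Q -> isomorphic Q S -> isomorphic P S.
Proof.
case=> f fb h [g gb h']; exists (g \o f); first exact: bij_comp.
by move=> x y /=; rewrite h' h.
Qed.

Definition qp_rep : Type := {n : nat & quasiPoset 'I_n}.
HB.instance Definition _ := Choice.on qp_rep.

Definition isorep (u v : qp_rep) : bool := isob (tagged u) (tagged v).

Fact isorep_refl : reflexive isorep.
Proof. by move=> u; apply/isobP/isomorphic_refl. Qed.

Fact isorep_sym : symmetric isorep.
Proof. by move=> u v; apply/isobP/isobP => /isomorphic_sym. Qed.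

Fact isorep_trans : transitive isorep.
Proof. by move=> v u w /isobP h /isobP /(isomorphic_trans h)/isobP. Qed.

Canonical isorep_equiv := EquivRel isorep isorep_refl isorep_sym isorep_trans.

Definition qp : Type := {eq_quot isorep}.
HB.instance Definition _ := Choice.on qp.
HB.instance Definition _ := EqQuotient.on qp.

Definition isoclass (A : finType) (P : quasiPoset A) : qp :=
  \pi_qp (Tagged (fun n => quasiPoset 'I_n)
            (pullback (@enum_val A predT) P) : qp_rep).

(* A chosen quasi-poset in the class [c]; everything below that uses it is
   invariant under isomorphism. *)
Definition qrep (c : qp) : quasiPoset 'I_(tag (repr c : qp_rep)) :=
  tagged (repr c : qp_rep).

Lemma isomorphic_pullback (A B : finType) (f : B -> A) (P : quasiPoset A) :
  bijective f -> isomorphic (pullback f P) P.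
Proof. by exists f => // x y; rewrite le_mkQP. Qed.

Lemma isoclassP (A B : finType) (P : quasiPoset A) (Q : quasiPoset B) :
  isoclass P = isoclass Q <-> isomorphic P Q.
Proof.
have hP := isomorphic_pullback P (@enum_val_bij A).
have hQ := isomorphic_pullback Q (@enum_val_bij B).
split=> [/eqmodP/isobP h|h].
  exact: isomorphic_trans (isomorphic_sym hP) (isomorphic_trans h hQ).
apply/eqmodP/isobP.
exact: isomorphic_trans hP (isomorphic_trans h (isomorphic_sym hQ)).
Qed.

Lemma isoclass_qrep (c : qp) : isoclass (qrep c) = c.
Proof.
rewrite -[RHS]reprK; apply/eqmodP/isobP.
exact: isomorphic_pullback (@enum_val_bij _).
Qed.

Lemma qrep_isoclass (A : finType) (P : quasiPoset A) :
  isomorphic (qrep (isoclass P)) P.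
Proof. by apply/isoclassP; rewrite isoclass_qrep. Qed.

Definition qp_one : qp := isoclass (indiscrete void).

Definition qp_mul (c d : qp) : qp := isoclass (qsum (qrep c) (qrep d)).

Lemma qp_mulE (A B : finType) (P : quasiPoset A) (Q : quasiPoset B) :
  qp_mul (isoclass P) (isoclass Q) = isoclass (qsum P Q).
Proof.
apply/isoclassP; have [f [f' fK f'K] hf] := qrep_isoclass P.
have [g [g' gK g'K] hg] := qrep_isoclass Q.
exists (fun u => match u with inl x => inl (f x) | inr y => inr (g y) end).
  exists (fun u => match u with inl x => inl (f' x) | inr y => inr (g' y) end).
    by case=> x; rewrite ?fK ?gK.
  by case=> x; rewrite ?f'K ?g'K.
by case=> x [] y; rewrite !le_mkQP //=.
Qed.

Fact qp_mulA : associative qp_mul.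
Proof.
move=> a b c; rewrite -[a]isoclass_qrep -[b]isoclass_qrep -[c]isoclass_qrep.
rewrite !qp_mulE; apply/isoclassP.
exists (fun u => match u with
  | inl x => inl (inl x) | inr (inl x) => inl (inr x) | inr (inr x) => inr x
  end).
  exists (fun u => match u with
    | inl (inl x) => inl x | inl (inr x) => inr (inl x) | inr x => inr (inr x)
    end); first by case=> [x|[x|x]].
  by case=> [[x|x]|x].
by case=> [x|[x|x]] [y|[y|y]]; rewrite !le_mkQP //= !le_mkQP.
Qed.

Fact qp_mulC : commutative qp_mul.
Proof.
move=> a b; rewrite -[a]isoclass_qrep -[b]isoclass_qrep !qp_mulE.
apply/isoclassP; exists (fun u => match u with inl x => inr x | inr x => inl x end).
  by exists (fun u => match u with inl x => inr x | inr x => inl x end); case.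
by case=> x [] y; rewrite !le_mkQP.
Qed.

Fact qp_mul1 : left_id qp_one qp_mul.
Proof.
move=> a; rewrite -[a]isoclass_qrep qp_mulE.
apply/isoclassP; apply: isomorphic_sym; exists inr.
  by exists (fun u => match u with inl x => of_void _ x | inr x => x end);
    [|case=> [[]|]].
by move=> x y; rewrite !le_mkQP.
Qed.

Fact qp_mulr1 : right_id qp_one qp_mul.
Proof. by move=> a; rewrite qp_mulC qp_mul1. Qed.

Fact qp_unit c d : qp_mul c d = qp_one -> c = qp_one /\ d = qp_one.
Proof.
rewrite -[c]isoclass_qrep -[d]isoclass_qrep qp_mulE => /isoclassP[f _ _].
split; apply/isoclassP.
  exists (fun x => f (inl x)); last by move=> x; case: (f (inl x)).
  by exists (fun v => of_void _ v) => [x|[]]; case: (f (inl x)).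
exists (fun x => f (inr x)); last by move=> x; case: (f (inr x)).
by exists (fun v => of_void _ v) => [x|[]]; case: (f (inr x)).
Qed.

HB.instance Definition _ :=
  Choice_isMonomialDef.Build qp qp_mulA qp_mul1 qp_mulr1 qp_unit.
HB.instance Definition _ := MonomialDef_isConomialDef.Build qp qp_mulC.

End IsoClasses.

Section Bialgebras.

Variable K : fieldType.

(* The monoid algebra of [qp] under disjoint union. *)
Definition Hqp : Type := {malg K[qp]}.
HB.instance Definition _ := GRing.ComAlgebra.on Hqp.

(* The tensor square of [Hqp]: <<(c, d)>> stands for c (x) d. *)
Definition Hqp2 : Type := {malg K[(qp * qp)%type]}.
HB.instance Definition _ := GRing.Lmodule.on Hqp2.

Definition linext (T : choiceType) (V : lmodType K) (f : T -> V)
    (x : {malg K[T]}) : V :=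
  \sum_(t <- msupp x) x@_t *: f t.

Definition Delta : Hqp -> Hqp2 :=
  linext (fun c : qp => \sum_(O in opens (qrep c))
    (<< (isoclass (restrict (qrep c) (~: O)),
         isoclass (restrict (qrep c) O)) >> : Hqp2)).

Definition delta : Hqp -> Hqp2 :=
  linext (fun c : qp =>
    \sum_(E : quasiPoset _ | is_equiv E && compatible E (qrep c))
    (<< (isoclass (contract (qrep c) E), isoclass (inter (qrep c) E)) >>
       : Hqp2)).

Definition eps (x : Hqp) : K := x@_(@mone qp).

Definition eps' : Hqp -> K^o :=
  linext (fun c : qp => (discrete (qrep c))%:R : K^o).

(* K[X] (x) K[X] is {poly {poly K}} = K[X, Y], with p (x) q = p(X) q(Y). The
   coproducts of K[X] are then the algebra morphisms [poly_XaY], X |-> X + Y,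
   and [poly_XmY], X |-> X Y; their counits are evaluation at 0 and at 1. *)
Definition tensor_map (phi psi : Hqp -> {poly K}) : Hqp2 -> {poly {poly K}} :=
  mmap (polyC \o polyC)
    (fun cd : qp * qp => (phi << cd.1 >>)^:P * (psi << cd.2 >>)%:P).

Definition alg_mor (A B : algType K) (f : A -> B) : Prop :=
  linear f /\ monoid_morphism f.

(* No condition on antipodes: bialgebra morphisms between Hopf algebras
   commute with them. *)
Definition hopf_mor (phi : Hqp -> {poly K}) : Prop :=
  [/\ alg_mor phi,
      forall x, poly_XaY (phi x) = tensor_map phi phi (Delta x)
    & forall x, (phi x).[0] = eps x].

Definition bialg_mor (phi : Hqp -> {poly K}) : Prop :=
  [/\ alg_mor phi,
      forall x, poly_XmY (phi x) = tensor_map phi phi (delta x)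
    & forall x, (phi x).[1] = eps' x].

Definition is_char (l : Hqp -> K^o) : Prop := alg_mor l.

Definition conv (l m : Hqp -> K^o) : Hqp -> K^o := fun x =>
  linext (fun cd : qp * qp => l << cd.1 >> * m << cd.2 >> : K^o) (delta x).

Definition act (phi : Hqp -> {poly K}) (l : Hqp -> K^o) : Hqp -> {poly K} :=
  fun x =>
  linext (fun cd : qp * qp => l << cd.2 >> *: phi << cd.1 >>) (delta x).

Definition char_inverse (l m : Hqp -> K^o) : Prop :=
  [/\ is_char l, is_char m, conv l m =1 eps' & conv m l =1 eps'].

Definition homogeneous (phi : Hqp -> {poly K}) : Prop :=
  forall (n : nat) (x : Hqp), (forall c, c \in msupp x -> cl (qrep c) = n) ->
  exists a : K, phi x = a *: 'X^n.

(* Objects characterised as "the unique x such that ..." are introduced with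
   Hilbert's [epsilon]. *)
Definition ehr_str_poly (A : finType) (P : quasiPoset A) : {poly K} :=
  epsilon (inhabits 0) (fun p : {poly K} =>
    forall k : nat, (1 <= k)%N -> p.[k%:R] = #|Lstr P k|%:R).

Definition ehr_str : Hqp -> {poly K} :=
  linext (fun c : qp => ehr_str_poly (qrep c)).

Definition is_phi0 (phi : Hqp -> {poly K}) : Prop :=
  [/\ hopf_mor phi, homogeneous phi
    & forall n : nat, (1 <= n)%N ->
        phi << isoclass (indiscrete 'I_n) >> = 'X].

Definition phi0 : Hqp -> {poly K} := epsilon (inhabits (fun=> 0)) is_phi0.

Definition lambda : Hqp -> K^o :=
  epsilon (inhabits (fun=> 0)) (fun l => is_char l /\
    forall c : qp, phi0 << c >> = l << c >> *: 'X^(cl (qrep c))).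

Definition alpha_str : Hqp -> K^o :=
  epsilon (inhabits (fun=> 0)) (fun l => is_char l /\
    ehr_str =1 act phi0 l).

End Bialgebras.

Arguments ehr_str K x : clear implicits.
Arguments phi0 K x : clear implicits.
Arguments lambda K x : clear implicits.
Arguments alpha_str K x : clear implicits.

(* Main.v *)
Require Import Defs.
From mathcomp Require Import all_boot all_algebra.
From HB Require Import structures.
From Stdlib Require Import ClassicalEpsilon.
From mathcomp Require Import finmap monalg.

Set Implicit Arguments.
Unset Strict Implicit.
Unset Printing Implicit Defensive.

Import GRing.Theory.

Local Open Scope ring_scope.

(** Everything rests on one family of sums. For a function [W] on isoclasses,
    let [N W k P] be the sum, over the monotone maps [f] from [P] to
    [{0, ..., k - 1}], of the product of the values of [W] on the restrictions
    of [P] to the fibres of [f]: the [k]-fold convolution power of [W] for the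
    coproduct [Delta]. Cutting [f] at a height shows that [N W] is compatible
    with [Delta] ([fibre_sumD]). Conversely, evaluating [phi_P (X + Y)] shows
    that a Hopf morphism [phi] is recovered from the character [phi(.)(1)],
    since [phi_P (k) = N (phi(.)(1)) k P] ([hopf_fibre_sum]), and also from its
    linear coefficients [a], since [m! [X^m] phi_P = N a m P] ([hopf_coef]).

    The number of strict maps is [N eps' k P]: a monotone map is strict when
    its fibres are discrete. Hence the difference in [k] of this number is a
    combination of the same numbers for smaller quasi-posets, which makes it a
    polynomial of degree at most [cl P], and [ehr_str] is a Hopf morphism. As
    its character at [1] is [eps'], it is the only Hopf morphism compatible
    with the counits of the [delta]-bialgebras: this is the uniqueness.

    For [delta], the pairs formed of [E <| P] and a strict map on [P / E]
    correspond to the monotone maps [g] on [P]: the classes of [E] are the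
    components of the fibres of [g], and [P | E] is [P] with the relations
    between distinct fibres removed ([sum_strict]). So [ehr_str <- w] has the
    values [N w k P] for every character [w] ([fibre_sum_delta]). Taking for
    [w] the character [ehr_str(.)(l)] gives
    [ehr_P (k l) = sum_E ehr_(P / E) (k) ehr_(P | E) (l)], as both sides satisfy
    the same recursion in [k]; taking [w = lambda] gives
    [phi0 = ehr_str <- lambda].

    The morphism [phi0] exists because the homogeneous part of degree [cl P] of
    [ehr_P] is again a Hopf morphism, by comparison of the terms of top degree.
    Let [c(P)] be the number of components of [P]. The polynomial [ehr_P] is
    divisible by [X^c(P)], and [alpha (P) = [X^c(P)] ehr_P] is a character with
    [ehr_str = phi0 <- alpha]: by [hopf_coef] the coefficients of both sides
    are sums over the maps with nonempty connected fibres ([ehr_phi0]).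
    Evaluating [ehr_str = phi0 <- alpha] at [1] yields [lambda * alpha = eps'].
    Taking the coefficient of [X^c(P)] in [phi0 = ehr_str <- lambda] yields
    [alpha * lambda = eps'], because [c(P / E) = c(P)] and [c(P) = cl P] exactly
    when [P] is discrete. *)

(** * Polynomials determined by their values at the positive integers *)

Lemma natr_polyP (R : idomainType) (p q : {poly R}) :
  injective (fun n : nat => n%:R : R) ->
  (forall k : nat, p.[k.+1%:R] = q.[k.+1%:R]) -> p = q.
Proof.
move=> inj h; apply/eqP; rewrite -subr_eq0; apply/eqP.
apply: (@roots_geq_poly_eq0 _ _ [seq i.+1%:R | i <- iota 0 (size (p - q))]).
- by apply/allP=> _ /mapP[i _ ->]; rewrite /root hornerD hornerN h subrr.
- by rewrite map_inj_uniq ?iota_uniq // => i j /inj[].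
- by rewrite size_map size_iota.
Qed.

Section Char0.
Variables (K : fieldType) (char0 : [pchar K] =i pred0).

Lemma natr_inj : injective (fun n : nat => n%:R : K).
Proof.
move=> m n /eqP h; wlog le: m n h / (m <= n)%N.
  by move=> H; case/orP: (leq_total m n) => /H; [apply|rewrite eq_sym in h; move/(_ h)].
have e : (n - m)%:R == 0 :> K by rewrite natrB // (eqP h) subrr.
move: e; rewrite ((pcharf0P K).1 char0) subn_eq0 => le'.
by apply/eqP; rewrite eqn_leq le.
Qed.

Lemma natr_polyK (p q : {poly K}) :
  (forall k : nat, p.[k.+1%:R] = q.[k.+1%:R]) -> p = q.
Proof. exact: natr_polyP natr_inj. Qed.

Lemma natr_polyXY (u v : {poly {poly K}}) :
  (forall k l : nat, u.[k%:R, l%:R] = v.[k%:R, l%:R]) -> u = v.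
Proof.
move=> h; apply: natr_polyP => [m n|k].
  by rewrite -!polyC_natr => /polyC_inj/natr_inj.
by apply: natr_polyK => l; rewrite -polyC_natr h.
Qed.

(** The discrete antiderivative; the leading term is integrated by
    [X^(n+1) / (n+1)], which leaves a polynomial of smaller degree. *)
Lemma antidifference (n : nat) (q : {poly K}) : (size q <= n)%N ->
  exists p : {poly K}, [/\ (size p <= n.+1)%N, p.[0] = 0
    & forall x, p.[x + 1] - p.[x] = q.[x]].
Proof.
elim: n q => [|n IH] q sq.
  exists 0; rewrite size_poly0; split=> // [|x]; rewrite ?horner0 //.
  by move: sq; rewrite leqn0 size_poly_eq0 => /eqP->; rewrite !horner0 subrr.
pose c := q`_n / n.+1%:R; pose d : {poly K} := ('X + 1) ^+ n.+1 - 'X^(n.+1).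
(* The coefficient of index [n + 1] cancels, the one of index [n] is [n + 1]. *)
have dE j : d`_j = 'C(n.+1, j)%:R *+ (j < n.+1)%N.
  rewrite coefB coefXn ['X + 1]addrC exprDn coef_sum.
  rewrite (eq_bigr (fun i : 'I_n.+2 => (j == i)%:R * 'C(n.+1, j)%:R)); last first.
    move=> i _; rewrite coefMn expr1n mul1r coefXn.
    by case: eqP => [->|_]; rewrite ?mul1r ?mul0r ?mul0rn.
  case: (ltngtP j n.+1) => [lt|gt|->]; rewrite ?mulr1n ?mulr0n.
  - rewrite subr0 (bigD1 (Ordinal (ltnW lt : j < n.+2)%N)) //= eqxx mul1r big1 ?addr0 //.
    move=> i ne; case: eqP => [e|]; rewrite ?mul0r //.
    by case/eqP: ne; apply: val_inj.
  - rewrite subr0 big1 // => i _; case: eqP => [e|]; rewrite ?mul0r //.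
    by have := ltn_ord i; rewrite -e ltnNge gt.
  - rewrite (bigD1 ord_max) //= eqxx binn mulr1 big1 ?addr0 ?subrr //.
    move=> i ne; case: eqP => [e|]; rewrite ?mul0r //.
    by case/eqP: ne; apply: val_inj.
have n0 : n.+1%:R != 0 :> K by rewrite ((pcharf0P K).1 char0).
have [|p [sp p0 pE]] := IH (q - c *: d).
  apply/leq_sizeP=> j le; rewrite coefB coefZ dE.
  case: (ltngtP j n) le => // [lt|->] _.
    rewrite ltnS leqNgt lt mulr0n mulr0 subr0.
    by move/leq_sizeP: sq; apply.
  by rewrite ltnSn binSn mulr1n /c divfK ?subrr.
exists (c *: 'X^(n.+1) + p); split=> [||x].
- rewrite (leq_trans (size_polyD _ _)) // geq_max (leq_trans sp) // andbT.
  by rewrite (leq_trans (size_scale_leq _ _)) // size_polyXn.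
- by rewrite hornerD hornerZ hornerXn expr0n mulr0 p0 addr0.
- rewrite !hornerD !hornerZ !hornerXn opprD addrACA pE hornerD hornerN hornerZ.
  rewrite /d hornerD hornerN hornerXn horner_exp hornerD hornerX hornerC.
  by rewrite mulrBr addrCA subrr addr0.
Qed.

End Char0.

(** * Linear maps on a monoid algebra *)

Section LinearExtension.
Variable K : fieldType.

Lemma linextU (T : choiceType) (V : lmodType K) (f : T -> V) t :
  linext f << t >> = f t.
Proof. by rewrite /linext msuppU oner_eq0 big_seq_fset1 mcoeffUU scale1r. Qed.

Lemma linextEw (T : choiceType) (V : lmodType K) (f : T -> V)
    (d : {fset T}) (x : {malg K[T]}) :
  (msupp x `<=` d)%fset -> linext f x = \sum_(t <- d) x@_t *: f t.
Proof.
move=> le; rewrite /linext (big_fset_incl _ le) // => t _ /mcoeff_outdom->.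
by rewrite scale0r.
Qed.

Lemma linext_linear (T : choiceType) (V : lmodType K) (f : T -> V) :
  linear (linext f).
Proof.
move=> a x y; pose d := (msupp x `|` msupp y)%fset.
rewrite !(@linextEw _ _ _ d) ?fsubsetUl ?fsubsetUr //.
  rewrite scaler_sumr -big_split; apply: eq_bigr => t _ /=.
  by rewrite mcoeffD mcoeffZ scalerDl scalerA.
apply: fsubset_trans (msuppD_le _ _) _.
by apply: fsetSU; apply: msuppZ_le.
Qed.

HB.instance Definition _ (T : choiceType) (V : lmodType K) (f : T -> V) :=
  GRing.isLinear.Build K {malg K[T]} V *:%R (linext f) (linext_linear f).

Lemma linear_malg_ext (T : choiceType) (V : lmodType K)
    (f g : {malg K[T]} -> V) :
  linear f -> linear g -> (forall t, f << t >> = g << t >>) -> f =1 g.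
Proof.
move=> lf lg h x.
pose F := HB.pack_for {linear {malg K[T]} -> V} f (GRing.isLinear.Build _ _ _ _ f lf).
pose G := HB.pack_for {linear {malg K[T]} -> V} g (GRing.isLinear.Build _ _ _ _ g lg).
rewrite -[f x]/(F x) -[g x]/(G x) (monalgE x) !raddf_sum; apply: eq_bigr => t _.
have -> : << x@_t *g t >> = x@_t *: << t >>.
  by apply/malgP=> u; rewrite mcoeffZ !mcoeffU mulrnAr mulr1.
transitivity (x@_t *: f << t >>); first exact: (GRing.scalable_linear lf).
by rewrite h; symmetry; exact: (GRing.scalable_linear lg).
Qed.

End LinearExtension.
(** * Restrictions, open sets and classes *)

Section Restrictions.
Implicit Types A B : finType.

Lemma le_restrict A (P : quasiPoset A) (B : {set A}) (x y : {x | x \in B}) :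
  le (restrict P B) x y = le P (val x) (val y).
Proof. exact: le_mkQP. Qed.

Lemma le_inter A (P E : quasiPoset A) x y :
  le (inter P E) x y = le P x y && le E x y.
Proof. exact: le_mkQP. Qed.

Lemma le_contract A (P E : quasiPoset A) x y :
  le (contract P E) x y = connect [rel x y | le P x y || le E x y] x y.
Proof. exact: le_mkQP. Qed.

Lemma quasiPoset_ext A (P Q : quasiPoset A) : le P =2 le Q -> P = Q.
Proof. by move=> h; apply: val_inj; apply/ffunP=> -[x y]; apply: h. Qed.

(** Stated with an injection and its image so that iterated restrictions, whose
    carriers are nested subtypes, can be compared. *)
Lemma isoclass_restrictE A B (P : quasiPoset A) (Q : quasiPoset B)
    (f : B -> A) (S : {set A}) :
  injective f -> S = f @: [set: B] ->
  (forall x y, le P (f x) (f y) = le Q x y) ->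
  isoclass (restrict P S) = isoclass Q.
Proof.
move=> fi SE h; symmetry; apply/isoclassP.
have fS x : f x \in S by rewrite SE imset_f.
exists (fun x => Sub (f x) (fS x) : {x | x \in S}); last first.
  by move=> x y; rewrite le_restrict h.
apply: inj_card_bij => [x y /(congr1 val)/fi //|].
by rewrite card_sig SE card_imset // cardsT.
Qed.

Lemma isoclass_restrictT A (P : quasiPoset A) :
  isoclass (restrict P [set: A]) = isoclass P.
Proof.
by apply: (@isoclass_restrictE _ _ _ _ id) => //; rewrite imset_id.
Qed.

Lemma isoclass_restrict2 A (P : quasiPoset A) (B : {set A})
    (O : {set {x | x \in B}}) :
  isoclass (restrict (restrict P B) O) = isoclass (restrict P (val @: O)).
Proof.
symmetry; apply: (@isoclass_restrictE _ _ _ _ (fun x : {x | x \in O} => val (val x))).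
- by move=> x y /val_inj/val_inj.
- apply/setP=> x; apply/imsetP/imsetP=> [[y yO ->]|[y _ ->]].
    by exists (Sub y yO : {x | x \in O}).
  by exists (val y) => //; apply: valP.
- by move=> x y; rewrite !le_restrict.
Qed.

Lemma isoclass_empty A (P : quasiPoset A) :
  #|A| = 0%N -> isoclass P = mone.
Proof.
move=> A0; have nA (x : A) : False.
  by move: (card0_eq A0 x); rewrite inE.
apply/isoclassP; exists (fun x => match nA x with end) => [|x]; last by case: (nA x).
by exists (fun v => of_void _ v) => [x|[]]; case: (nA x).
Qed.

Lemma isoclass_eq1 A (P : quasiPoset A) :
  (isoclass P == mone) = (#|A| == 0%N).
Proof.
apply/eqP/eqP=> [/isoclassP[f fb _]|]; last exact: isoclass_empty.
by rewrite (bij_eq_card fb) card_void.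
Qed.

Lemma mul_isoclass A B (P : quasiPoset A) (Q : quasiPoset B) :
  mmul (isoclass P) (isoclass Q) = isoclass (qsum P Q).
Proof. exact: qp_mulE. Qed.

(** The source of all factorizations: characters split along parts that are
    not related to each other, such as fibres or components. *)
Lemma isoclass_restrictU A (P : quasiPoset A) (B C : {set A}) :
  [disjoint B & C] ->
  {in B & C, forall x y, ~~ le P x y && ~~ le P y x} ->
  isoclass (restrict P (B :|: C))
    = mmul (isoclass (restrict P B)) (isoclass (restrict P C)).
Proof.
move=> dBC h; rewrite mul_isoclass.
pose f (u : {x | x \in B} + {x | x \in C}) : A :=
  match u with inl x => val x | inr y => val y end.
have nBC (x : {x | x \in B}) (y : {x | x \in C}) : val x <> val y.
  by move=> e; move: (disjointFr dBC (valP x)); rewrite e (valP y).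
apply: (@isoclass_restrictE _ _ _ _ f).
- move=> [x|x] [y|y] //= => [/val_inj->//|/nBC//|/esym/nBC//|/val_inj->//].
- apply/setP=> x; rewrite inE; apply/orP/imsetP=> [[xB|xC]|[[y|y] _ ->]].
  + by exists (inl (Sub x xB)).
  + by exists (inr (Sub x xC)).
  + by left; apply: valP.
  + by right; apply: valP.
- move=> [x|x] [y|y]; rewrite [RHS]le_mkQP /= ?le_restrict //; apply: negbTE.
  + by case/andP: (h _ _ (valP x) (valP y)).
  + by case/andP: (h _ _ (valP y) (valP x)).
Qed.

Lemma restrict_eq A (P Q : quasiPoset A) (S : {set A}) :
  {in S &, le P =2 le Q} -> restrict P S = restrict Q S.
Proof.
by move=> h; apply: quasiPoset_ext => x y; rewrite !le_restrict h ?(valP x) ?(valP y).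
Qed.

Lemma opensP A (P : quasiPoset A) (O : {set A}) :
  reflect (forall i j, i \in O -> le P i j -> j \in O) (O \in opens P).
Proof.
rewrite inE; apply: (iffP forallP) => [h i j iO ij|h i].
  by move/forallP/(_ j)/implyP: (h i); rewrite iO ij; apply.
by apply/forallP=> j; apply/implyP=> /andP[]; apply: h.
Qed.

(** Needed because [Delta] sums over the opens of a chosen representative. *)
Lemma opens_iso_sum A B (P : quasiPoset A) (Q : quasiPoset B)
    (V : nmodType) (F : qp -> qp -> V) :
  isomorphic P Q ->
  \sum_(O in opens P) F (isoclass (restrict P (~: O))) (isoclass (restrict P O))
  = \sum_(O in opens Q) F (isoclass (restrict Q (~: O))) (isoclass (restrict Q O)).
Proof.
case=> f [g fK gK] h.
have pre (S : {set B}) : isoclass (restrict P (f @^-1: S)) = isoclass (restrict Q S).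
  symmetry; apply: (@isoclass_restrictE _ _ _ _ (fun x : {x | x \in f @^-1: S} => f (val x))).
  - by move=> x y /(can_inj fK)/val_inj.
  - apply/setP=> y; apply/idP/imsetP=> [yS|[x _ ->]].
      have gy : g y \in f @^-1: S by rewrite inE gK.
      by exists (Sub (g y) gy : {x | x \in f @^-1: S}); rewrite ?gK.
    by have := valP x; rewrite inE.
  - by move=> x y; rewrite le_restrict h.
rewrite (reindex (fun S : {set B} => f @^-1: S)) /=; last first.
  exists (fun S : {set A} => g @^-1: S) => S _; apply/setP=> x;
  by rewrite !inE ?fK ?gK.
apply: eq_big => [S|S _]; last by rewrite -preimsetC !pre.
apply/opensP/opensP=> hS i j.
  by move=> iS ij; have := hS (g i) (g j); rewrite !inE !gK -h !gK; apply.
by rewrite !inE -h => /hS; apply.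
Qed.

Lemma card_imset_ker (T : finType) (U V : finType) (f : T -> U) (g : T -> V)
    (D : {pred T}) :
  {in D &, forall x y, (f x == f y) = (g x == g y)} -> #|f @: D| = #|g @: D|.
Proof.
move=> h; pose k x := (f x, g x).
have -> : f @: D = fst @: (k @: D) by rewrite -imset_comp; apply: eq_imset.
have -> : g @: D = snd @: (k @: D) by rewrite -imset_comp; apply: eq_imset.
rewrite (card_in_imset (f := fst)) ?(card_in_imset (f := snd)) //.
  move=> _ _ /imsetP[x xD ->] /imsetP[y yD ->] /= e.
  by rewrite /k e; congr (_, _); apply/eqP; rewrite h // e.
move=> _ _ /imsetP[x xD ->] /imsetP[y yD ->] /= e.
by rewrite /k e; congr (_, _); apply/eqP; rewrite -h // e.
Qed.

Lemma sim_refl A (P : quasiPoset A) x : sim P x x.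
Proof. by rewrite /sim le_refl. Qed.

Lemma sim_class_eq A (P : quasiPoset A) x y :
  ([set z | sim P x z] == [set z | sim P y z]) = sim P x y.
Proof.
apply/eqP/idP=> [/setP/(_ y)|/andP[xy yx]]; first by rewrite !inE sim_refl.
apply/setP=> z; rewrite !inE; apply/andP/andP=> -[h1 h2]; split.
- exact: le_trans yx h1.
- exact: le_trans h2 xy.
- exact: le_trans xy h1.
- exact: le_trans h2 yx.
Qed.

Lemma sim_pullback A B (f : B -> A) (P : quasiPoset A) x y :
  sim (pullback f P) x y = sim P (f x) (f y).
Proof. by rewrite /sim !le_mkQP. Qed.

Lemma cl_restrict A (P : quasiPoset A) (B : {set A}) :
  cl (restrict P B) = #|[set [set y | sim P x y] | x in B]|.
Proof.
have -> : [set [set y | sim P x y] | x in B]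
    = [set [set y | sim P (val x) y] | x : {x | x \in B}].
  apply/setP=> S; apply/imsetP/imsetP=> [[x xB ->]|[x _ ->]].
    by exists (Sub x xB : {x | x \in B}).
  by exists (val x); first apply: valP.
rewrite /cl; apply: (@card_imset_ker _ _ _ (fun x => [set y | sim (restrict P B) x y])
  (fun x => [set y | sim P (val x) y])) => x y _ _.
by rewrite !sim_class_eq sim_pullback.
Qed.

Lemma cl_iso A B (P : quasiPoset A) (Q : quasiPoset B) :
  isomorphic P Q -> cl P = cl Q.
Proof.
case=> f fb h; pose F x := [set z | sim Q (f x) z].
rewrite /cl (_ : [set [set y | sim Q x y] | x : B] = [set F x | x : A]); last first.
  case: (fb) => g fK gK.
  apply/setP=> S; apply/imsetP/imsetP=> [[y _ ->]|[x _ ->]].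
    by exists (g y); rewrite // /F gK.
  by exists (f x).
apply: (@card_imset_ker _ _ _ (fun x => [set y | sim P x y]) F) => x y _ _.
by rewrite !sim_class_eq /sim !h.
Qed.

Lemma cl_qrep A (P : quasiPoset A) : cl (qrep (isoclass P)) = cl P.
Proof. exact/cl_iso/qrep_isoclass. Qed.

(** An open set is a union of classes, since it is closed upwards. *)
Lemma cl_open A (P : quasiPoset A) (O : {set A}) : O \in opens P ->
  cl P = (cl (restrict P (~: O)) + cl (restrict P O))%N.
Proof.
move/opensP=> Oo; pose F x := [set y | sim P x y].
have e0 : (F @: ~: O) :&: (F @: O) = set0.
  apply/setP=> S; rewrite !inE; apply/andP=> -[/imsetP[x xO ->] /imsetP[y yO /eqP]].
  rewrite sim_class_eq => /andP[_ yx]; move: xO; rewrite inE.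
  by rewrite (Oo _ _ yO yx).
rewrite !cl_restrict -cardsUI e0 cards0 addn0 -imsetU; congr #|pred_of_set _|.
by apply/setP=> S; apply/imsetP/imsetP=> -[x _ ->]; exists x; rewrite ?inE ?orNb.
Qed.

Lemma cl_qsum A B (P : quasiPoset A) (Q : quasiPoset B) :
  cl (qsum P Q) = (cl P + cl Q)%N.
Proof.
pose O : {set (A + B)} := [set inr y | y : B].
have inlO x : inl x \notin O by apply/imsetP=> -[].
have inrO y : inr y \in O by apply: imset_f.
rewrite (@cl_open _ _ O); last first.
  by apply/opensP=> -[i|i] [j|j]; rewrite ?(negbTE (inlO _)) ?inrO // le_mkQP.
congr addn.
  rewrite -[LHS]cl_qrep -[RHS]cl_qrep; congr (cl (qrep _)).
  apply: (@isoclass_restrictE _ _ _ _ inl) => [x y []//||x y]; last by rewrite le_mkQP.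
  apply/setP=> -[x|y]; rewrite !inE ?inlO ?inrO; symmetry; first exact: imset_f.
  by apply/imsetP=> -[].
rewrite -[LHS]cl_qrep -[RHS]cl_qrep; congr (cl (qrep _)).
apply: (@isoclass_restrictE _ _ _ _ inr) => [x y []//||x y]; last by rewrite le_mkQP.
by apply/setP=> u; apply/imsetP/imsetP=> -[x _ ->]; exists x.
Qed.

End Restrictions.
(** * Sums over monotone maps *)

Section FibreSums.

Definition monotone (A : finType) (P : quasiPoset A) (k : nat) :
    {set {ffun A -> 'I_k}} :=
  [set f : {ffun A -> 'I_k} |
    [forall i, forall j, le P i j ==> (f i <= f j)%N]].

Definition fibre (A : finType) (k : nat) (f : {ffun A -> 'I_k}) (i : 'I_k) :
    {set A} := f @^-1: [set i].

Lemma monotoneP (A : finType) (P : quasiPoset A) k (f : {ffun A -> 'I_k}) :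
  reflect (forall i j, le P i j -> (f i <= f j)%N) (f \in monotone P k).
Proof.
rewrite inE; apply: (iffP forallP) => [h i j|h i].
  by move/forallP/(_ j)/implyP: (h i).
by apply/forallP=> j; apply/implyP/h.
Qed.

Lemma in_fibre (A : finType) k (f : {ffun A -> 'I_k}) i x :
  (x \in fibre f i) = (f x == i).
Proof. by rewrite !inE. Qed.

Variable K : fieldType.

(** The [k]-fold convolution power of [W] with respect to [Delta]. *)
Definition fibre_sum (W : qp -> K) (k : nat) (A : finType) (P : quasiPoset A)
    : K :=
  \sum_(f in monotone P k) \prod_(i < k) W (isoclass (restrict P (fibre f i))).

Section Glue.
Variables (A : finType) (P : quasiPoset A) (k l : nat) (O : {set A}).

Let T : Type :=
  ({ffun {x | x \in ~: O} -> 'I_k} * {ffun {x | x \in O} -> 'I_l})%type.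

Fact notin_setC x : ~ x \in O -> x \in ~: O.
Proof. by rewrite inE => /negP. Qed.

(** The map with values [u.1] below the cut [O] and [k + u.2] above it. *)
Definition glue (u : T) : {ffun A -> 'I_(k + l)} := [ffun x =>
  match @idP (x \in O) with
  | ReflectT h => rshift k (u.2 (Sub x h))
  | ReflectF h => lshift l (u.1 (Sub x (notin_setC h)))
  end].

Lemma glueO u (y : {x | x \in O}) : glue u (val y) = rshift k (u.2 y).
Proof.
rewrite ffunE; case: {-}_ / idP => h; last by case: h; apply: valP.
by congr (rshift k (u.2 _)); apply: val_inj.
Qed.

Lemma glueC u (y : {x | x \in ~: O}) : glue u (val y) = lshift l (u.1 y).
Proof.
rewrite ffunE; case: {-}_ / idP => h; last by congr (lshift l (u.1 _)); apply: val_inj.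
by have := valP y; rewrite inE h.
Qed.

Lemma glue_ge u x : (k <= glue u x)%N = (x \in O).
Proof.
case: (boolP (x \in O)) => xO.
  by rewrite -[x]/(val (Sub x xO : {x | x \in O})) glueO /= leq_addr.
have xC : x \in ~: O by rewrite inE.
rewrite -[x]/(val (Sub x xC : {x | x \in ~: O})) glueC /=.
by apply/negbTE; rewrite -ltnNge ltn_ord.
Qed.

Lemma glue_inj : injective glue.
Proof.
move=> [g h] [g' h'] /ffunP e; congr (_, _); apply/ffunP=> y.
  by have := e (val y); rewrite !glueC => /lshift_inj.
by have := e (val y); rewrite !glueO => /rshift_inj.
Qed.

Lemma glue_fibre_l u i :
  val @: fibre u.1 i = fibre (glue u) (lshift l i).
Proof.
apply/setP=> x; rewrite in_fibre; apply/imsetP/eqP=> [[y + ->]|e].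
  by rewrite in_fibre glueC => /eqP->.
have xC : x \in ~: O by rewrite inE -(glue_ge u) e /= -ltnNge ltn_ord.
exists (Sub x xC) => //; rewrite in_fibre.
by move: e; rewrite -[x]/(val (Sub x xC : {x | x \in ~: O})) glueC => /lshift_inj->.
Qed.

Lemma glue_fibre_r u i :
  val @: fibre u.2 i = fibre (glue u) (rshift k i).
Proof.
apply/setP=> x; rewrite in_fibre; apply/imsetP/eqP=> [[y + ->]|e].
  by rewrite in_fibre glueO => /eqP->.
have xO : x \in O by rewrite -(glue_ge u) e leq_addr.
exists (Sub x xO) => //; rewrite in_fibre.
by move: e; rewrite -[x]/(val (Sub x xO : {x | x \in O})) glueO => /rshift_inj->.
Qed.

Lemma glue_image : O \in opens P ->
  [set f in monotone P (k + l) | [set x | (k <= f x)%N] == O]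
  = glue @: setX (monotone (restrict P (~: O)) k) (monotone (restrict P O) l).
Proof.
move/opensP=> Oo; apply/setP=> f; rewrite inE; apply/andP/imsetP.
  case=> /monotoneP fm /eqP/setP fO.
  have ge (y : {x | x \in O}) : (f (val y) - k < l)%N.
    have := valP y; rewrite -fO inE => ky.
    by rewrite -(ltn_add2l k) subnKC // ltn_ord.
  have lt (y : {x | x \in ~: O}) : (f (val y) < k)%N.
    by have := valP y; rewrite inE -fO inE -ltnNge.
  exists ([ffun y => Ordinal (lt y)], [ffun y => Ordinal (ge y)]).
    rewrite inE; apply/andP; split; apply/monotoneP=> i j;
      rewrite le_restrict !ffunE => /fm //= ij.
    exact: leq_sub2r.
  apply/ffunP=> x; apply: val_inj; case: (boolP (x \in O)) => xO.
    have := xO; rewrite -fO inE => kx.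
    by rewrite -[x in RHS]/(val (Sub x xO : {x | x \in O})) glueO /= ffunE /= subnKC.
  have xC : x \in ~: O by rewrite inE.
  by rewrite -[x in RHS]/(val (Sub x xC : {x | x \in ~: O})) glueC /= ffunE.
case=> -[g h]; rewrite inE /= => /andP[/monotoneP gm /monotoneP hm] ->.
split; last by apply/eqP/setP=> x; rewrite inE glue_ge.
apply/monotoneP=> i j ij.
case: (boolP (i \in O)) => iO.
  have jO := Oo _ _ iO ij.
  rewrite -[i]/(val (Sub i iO : {x | x \in O})) -[j]/(val (Sub j jO : {x | x \in O})).
  by rewrite !glueO leq_add2l hm // le_restrict.
have iC : i \in ~: O by rewrite inE.
rewrite -[i]/(val (Sub i iC : {x | x \in ~: O})) glueC.
case: (boolP (j \in O)) => jO.
  by apply: (leq_trans (ltnW (ltn_ord (g _)))); rewrite glue_ge.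
have jC : j \in ~: O by rewrite inE.
rewrite -[j]/(val (Sub j jC : {x | x \in ~: O})) glueC /=.
by rewrite gm // le_restrict.
Qed.

End Glue.

(** Cutting a monotone map at height [k] exhibits the open set where it takes
    its upper values: this is the compatibility of these sums with [Delta]. *)
Lemma fibre_sumD (W : qp -> K) (k l : nat) (A : finType) (P : quasiPoset A) :
  fibre_sum W (k + l) P =
  \sum_(O in opens P)
    fibre_sum W k (restrict P (~: O)) * fibre_sum W l (restrict P O).
Proof.
rewrite {1}/fibre_sum.
rewrite (partition_big (fun f : {ffun A -> 'I_(k + l)} => [set x | (k <= f x)%N])
  (mem (opens P))) /=; last first.
  move=> f /monotoneP fm; apply/opensP=> i j; rewrite !inE => ki /fm.
  exact: leq_trans.
apply: eq_bigr => O Oo; rewrite big_distrlr /= pair_big /=.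
rewrite (eq_bigl (mem (@glue A k l O @: setX (monotone (restrict P (~: O)) k)
  (monotone (restrict P O) l)))); last by move=> f; rewrite -glue_image // !inE.
rewrite big_imset /=; last by move=> ? ? _ _; apply: glue_inj.
apply: eq_big => [[g h]|[g h] _]; first by rewrite inE.
rewrite big_split_ord; congr (_ * _); apply: eq_bigr => i _.
  by rewrite -(glue_fibre_l (g, h)) isoclass_restrict2.
by rewrite -(glue_fibre_r (g, h)) isoclass_restrict2.
Qed.

Lemma fibre_sum0 (W : qp -> K) (A : finType) (P : quasiPoset A) :
  fibre_sum W 0 P = (isoclass P == mone)%:R.
Proof.
rewrite isoclass_eq1 /fibre_sum; under eq_bigr do rewrite big_ord0.
rewrite sumr_const; case: eqP => A0.
  rewrite (_ : monotone P 0 = setT) ?cardsT ?card_ffun ?A0 //.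
  apply/setP=> f; rewrite in_setT; apply/monotoneP=> i.
  by move: (card0_eq A0 i); rewrite inE.
rewrite (_ : monotone P 0 = set0) ?cards0 //; apply/setP=> f; rewrite in_set0.
apply/negP=> _; apply: A0; apply: eq_card0 => x; by case: (f x).
Qed.

Lemma fibre_sum1 (W : qp -> K) (A : finType) (P : quasiPoset A) :
  fibre_sum W 1 P = W (isoclass P).
Proof.
rewrite /fibre_sum (big_pred1 [ffun=> ord0]) => [|f].
  rewrite big_ord1 -[in RHS]isoclass_restrictT; congr (W (isoclass (restrict P _))).
  by apply/setP=> x; rewrite in_fibre ffunE in_setT.
rewrite /= (_ : f == _); last by apply/eqP/ffunP=> x; rewrite ffunE [f x]ord1.
by apply/monotoneP=> i j; rewrite !ord1.
Qed.

(** [fibre_sum W] is the only solution of the recursion obtained by splitting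
    off the fibre of the largest value. *)
Lemma fibre_sum_unique (W : qp -> K) (F : nat -> qp -> K) :
  (forall c, F 0%N c = (c == mone)%:R) ->
  (forall k (A : finType) (P : quasiPoset A), F k.+1 (isoclass P) =
     \sum_(O in opens P)
       F k (isoclass (restrict P (~: O))) * W (isoclass (restrict P O))) ->
  forall k (A : finType) (P : quasiPoset A), F k (isoclass P) = fibre_sum W k P.
Proof.
move=> F0 FS; elim=> [|k IH] A P; first by rewrite F0 fibre_sum0.
rewrite FS -addn1 fibre_sumD; apply: eq_bigr => O _.
by rewrite IH fibre_sum1.
Qed.

Lemma discreteP (A : finType) (P : quasiPoset A) :
  reflect (forall x y, le P x y -> le P y x) (discrete P).
Proof.
apply: (iffP forallP) => [h x y xy|h x].
  by move/forallP/(_ y): (h x); rewrite /sim xy => /eqP/esym.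
apply/forallP=> y; rewrite /sim; case xy: (le P x y) => //=.
by rewrite h.
Qed.

Lemma discrete_iso (A B : finType) (P : quasiPoset A) (Q : quasiPoset B) :
  isomorphic P Q -> discrete P = discrete Q.
Proof.
case=> f [g fK gK] h; apply/discreteP/discreteP=> d x y.
  by rewrite -[x]gK -[y]gK !h; apply: d.
by rewrite -!h; apply: d.
Qed.

Lemma LstrP (A : finType) (P : quasiPoset A) k (f : {ffun A -> 'I_k}) :
  reflect [/\ f \in monotone P k
    & forall x y, le P x y -> f x = f y -> le P y x] (f \in Lstr P k).
Proof.
rewrite inE [f \in _]inE; apply: (iffP andP) => -[fm fs]; split=> //.
  move=> x y xy e; move/forallP/(_ x)/forallP/(_ y): fs.
  by rewrite xy e eqxx => /andP[].
apply/forallP=> x; apply/forallP=> y; apply/implyP=> /andP[xy /eqP e].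
by rewrite /sim xy fs.
Qed.

(** A monotone map is strict exactly when its fibres are discrete. *)
Lemma card_Lstr (A : finType) (P : quasiPoset A) k :
  #|Lstr P k|%:R = fibre_sum (fun c => (discrete (qrep c))%:R) k P.
Proof.
rewrite /fibre_sum -sum1_card natr_sum [RHS]big_mkcond [LHS]big_mkcond /=.
apply: eq_bigr => f _; case: LstrP => [[-> fs]|nL].
  rewrite big1 // => i _; rewrite (discrete_iso (qrep_isoclass _)).
  case: discreteP => // -[] x y; rewrite !le_restrict => /fs; apply.
  have := valP x; have := valP y.
  by rewrite /= !in_fibre => /eqP-> /eqP->.
case: ifP => // fm; case: (boolP [forall i, discrete (restrict P (fibre f i))]).
  move=> /forallP d; case: nL; split=> // x y xy e.
  have xf : x \in fibre f (f y) by rewrite in_fibre e.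
  have yf : y \in fibre f (f y) by rewrite in_fibre.
  move/discreteP/(_ (Sub x xf) (Sub y yf)): (d (f y)).
  by rewrite !le_restrict; apply.
rewrite negb_forall => /existsP[i /negbTE nd].
by rewrite (bigD1 i) //= (discrete_iso (qrep_isoclass _)) nd mul0r.
Qed.

End FibreSums.
(** * Components, contractions and monotone maps *)

Section Components.

Definition clopen (A : finType) (P : quasiPoset A) : {set {set A}} :=
  [set O | (O \in opens P) && (~: O \in opens P)].

Lemma clopenP (A : finType) (P : quasiPoset A) (O : {set A}) :
  reflect (forall i j, le P i j -> (i \in O) = (j \in O)) (O \in clopen P).
Proof.
rewrite inE; apply: (iffP andP) => [[/opensP h /opensP h'] i j ij|h].
  apply/idP/idP=> [iO|jO]; first exact: h ij.
  by apply: contraLR jO => iO; have := h' i j; rewrite !inE; apply.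
split; apply/opensP=> i j; rewrite ?inE => + ij; rewrite (h _ _ ij) //.
Qed.

Fact components_refl (A : finType) (P : quasiPoset A) :
  reflexive [rel x y | [forall O in clopen P, (x \in O) == (y \in O)]].
Proof. by move=> x; apply/forall_inP. Qed.

Fact components_trans (A : finType) (P : quasiPoset A) :
  transitive [rel x y | [forall O in clopen P, (x \in O) == (y \in O)]].
Proof.
move=> y x z /forall_inP xy /forall_inP yz; apply/forall_inP=> O OP.
by rewrite (eqP (xy O OP)) yz.
Qed.

(** The relation of not being separated by a clopen set; in a finite space its
    classes are the connected components. *)
Definition components (A : finType) (P : quasiPoset A) : quasiPoset A :=
  mkQP (@components_refl A P) (@components_trans A P).

Lemma componentsP (A : finType) (P : quasiPoset A) x y :
  reflect (forall O, O \in clopen P -> (x \in O) = (y \in O)) (le (components P) x y).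
Proof.
rewrite le_mkQP; apply: (iffP forall_inP) => h O /h; first by move/eqP.
by move->.
Qed.

Lemma components_sym (A : finType) (P : quasiPoset A) x y :
  le (components P) x y = le (components P) y x.
Proof. by apply/componentsP/componentsP=> h O /h. Qed.

Lemma components_equiv (A : finType) (P : quasiPoset A) : is_equiv (components P).
Proof. by apply/forallP=> x; apply/forallP=> y; rewrite components_sym. Qed.

Lemma le_components (A : finType) (P : quasiPoset A) x y :
  le P x y -> le (components P) x y.
Proof. by move=> xy; apply/componentsP=> O /clopenP/(_ _ _ xy). Qed.

Lemma connectedP (A : finType) (P : quasiPoset A) :
  reflect (forall O, O \in clopen P -> O = set0 \/ O = [set: A]) (connected P).
Proof.
apply: (iffP forall_inP) => [h O|h O Oo].
  rewrite inE => /andP[o1 o2]; move: (h _ o1); rewrite o2 /=.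
  by case/orP=> /eqP; [left|right].
apply/implyP=> Oc; have [|->|->] := h O; rewrite ?eqxx ?orbT //.
by rewrite inE Oo.
Qed.

Lemma connected_componentsP (A : finType) (P : quasiPoset A) :
  reflect (forall x y, le (components P) x y) (connected P).
Proof.
apply: (iffP (connectedP _)) => [h x y|h O Oc].
  by apply/componentsP=> O /h[->|->]; rewrite !inE.
have [->|[x xO]] := set_0Vmem O; [by left|right].
by apply/setP=> y; rewrite inE -(componentsP _ _ _ (h x y)) // xO.
Qed.

(** Connectedness of a part, tested with subsets of the ambient type. *)
Lemma connected_restrictP (A : finType) (P : quasiPoset A) (S : {set A}) :
  reflect (forall U : {set A},
      {in S &, forall i j, le P i j -> (i \in U) = (j \in U)} ->
      {in S &, forall x y, (x \in U) = (y \in U)})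
    (connected (restrict P S)).
Proof.
apply: (iffP (connected_componentsP _)) => [h U hU x y xS yS|h x y].
  pose O := [set z : {x | x \in S} | val z \in U].
  have OE z : (z \in O) = (val z \in U) by rewrite inE.
  move/componentsP: (h (Sub x xS) (Sub y yS)) => /(_ O).
  rewrite !OE; apply; apply/clopenP=> i j; rewrite le_restrict !OE.
  by apply: hU; apply: valP.
apply/componentsP=> O Oc; have hO := elimT (clopenP _ _) Oc.
have im (z : {x | x \in S}) : (val z \in val @: O) = (z \in O).
  by rewrite mem_imset //; apply: val_inj.
rewrite -!im; apply: h; try exact: valP.
move=> i j iS jS ij; have := hO (Sub i iS) (Sub j jS).
by rewrite le_restrict -!im; apply.
Qed.

Lemma is_equivP (A : finType) (E : quasiPoset A) :
  reflect (forall x y, le E x y -> le E y x) (is_equiv E).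
Proof.
apply: (iffP forallP) => [h x y|h x]; first by move/forallP/(_ y)/eqP: (h x) => ->.
by apply/forallP=> y; apply/eqP; apply/idP/idP; apply: h.
Qed.

Lemma compatibleP (A : finType) (E P : quasiPoset A) :
  reflect ((forall x, connected (restrict P [set y | le E x y])) /\
           (forall x y, sim (contract P E) x y = le E x y)) (compatible E P).
Proof.
apply: (iffP andP) => -[h1 h2]; split.
- exact/forallP.
- by move=> x y; move/forallP/(_ x)/forallP/(_ y)/eqP: h2.
- exact/forallP.
- by apply/forallP=> x; apply/forallP=> y; rewrite h2.
Qed.

Lemma contract_le (A : finType) (P E : quasiPoset A) x y :
  le P x y -> le (contract P E) x y.
Proof. by move=> xy; rewrite le_contract connect1 //= xy. Qed.

Lemma contract_equiv (A : finType) (P E : quasiPoset A) x y :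
  le E x y -> le (contract P E) x y.
Proof. by move=> xy; rewrite le_contract connect1 //= xy orbT. Qed.

Lemma contract_ind (A : finType) (P E : quasiPoset A) (R : rel A) :
  reflexive R -> transitive R -> (forall x y, le P x y -> R x y) ->
  (forall x y, le E x y -> R x y) ->
  forall x y, le (contract P E) x y -> R x y.
Proof.
move=> Rr Rt hP hE x y; rewrite le_contract => /connectP[p].
elim: p x => [|z p IH] x /=; first by move=> _ ->.
case/andP=> xz zp yE; apply: Rt (IH _ zp yE).
by case/orP: xz => [/hP|/hE].
Qed.

Definition kernel (A : finType) k (f : {ffun A -> 'I_k}) : quasiPoset A :=
  mkQP (r := fun x y => f x == f y) (fun x => eqxx (f x))
    (fun y x z xy => etrans (congr1 (eq_op^~ _) (eqP xy))).

Lemma le_kernel (A : finType) k (f : {ffun A -> 'I_k}) x y :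
  le (kernel f) x y = (f x == f y).
Proof. exact: le_mkQP. Qed.

(** If a strict map on [P / E] takes the same value on [i <= j], then [i] and
    [j] are [E]-equivalent; so no relation inside a fibre leaves a class of [E]. *)
Lemma compatible_strict (A : finType) (E P : quasiPoset A) k
    (g : {ffun A -> 'I_k}) :
  is_equiv E -> compatible E P -> g \in Lstr (contract P E) k ->
  g \in monotone P k /\ E = components (inter P (kernel g)).
Proof.
move=> /is_equivP Es /compatibleP[Ec Esim] /LstrP[/monotoneP gm gs].
have Eg x y : le E x y -> g x = g y.
  move=> xy; apply/val_inj/eqP; rewrite eqn_leq.
  by rewrite !gm ?contract_equiv // Es.
split; first by apply/monotoneP=> i j ij; apply: gm; apply: contract_le.
apply: quasiPoset_ext => x y; apply/idP/componentsP=> [xy O /clopenP Oc|h].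
  move/connected_restrictP: (Ec x) => /(_ O); apply; rewrite ?inE ?le_refl //.
  move=> i j; rewrite !inE => xi xj ij; apply: Oc.
  by rewrite le_inter ij le_kernel -(Eg _ _ xi) -(Eg _ _ xj) eqxx.
have := h [set z | le E x z]; rewrite [x \in _]inE [y \in _]inE le_refl => <- //.
apply/clopenP=> i j; rewrite le_inter le_kernel !inE => /andP[ij /eqP gij].
have ijE : le E i j.
  rewrite -Esim /sim contract_le //=; apply: gs gij.
  exact: contract_le.
by apply/idP/idP=> [/le_trans|]; [apply|move=> xj; apply: le_trans xj (Es _ _ ijE)].
Qed.

(** Along a chain in [P / E] the values of [g] increase; if they are equal at
    both ends the chain stays in a fibre of [g], where relations of [P] are
    contained in [E]. *)
Lemma strict_compatible (A : finType) (P : quasiPoset A) k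
    (g : {ffun A -> 'I_k}) (E := components (inter P (kernel g))) :
  g \in monotone P k ->
  [/\ is_equiv E, compatible E P, g \in Lstr (contract P E) k
    & inter P E = inter P (kernel g)].
Proof.
move=> /monotoneP gm.
have Eg x y : le E x y -> g x = g y.
  move/componentsP/(_ [set z | g z == g x]).
  rewrite [x \in _]inE [y \in _]inE eqxx => h.
  apply/esym/eqP; rewrite -h //; apply/clopenP=> i j.
  by rewrite le_inter le_kernel !inE => /andP[_ /eqP->].
have PE x y : le P x y -> g x = g y -> le E x y.
  by move=> xy e; apply: le_components; rewrite le_inter xy le_kernel e eqxx.
have con x y : le (contract P E) x y -> (g x <= g y)%N && ((g x == g y) ==> le E x y).
  move: x y.
  apply: (contract_ind (R := fun x y => (g x <= g y)%N && ((g x == g y) ==> le E x y))).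
  - by move=> x; rewrite leqnn le_refl implybT.
  - move=> y x z /andP[xy /implyP xyE] /andP[yz /implyP yzE].
    rewrite (leq_trans xy yz); apply/implyP=> /eqP e.
    have exy : g x = g y.
      by apply/val_inj/eqP; rewrite eqn_leq xy e yz.
    by apply: le_trans (xyE _) (yzE _); rewrite -?e exy.
  - by move=> x y xy; rewrite gm //; apply/implyP=> /eqP; apply: PE.
  - by move=> x y xy; rewrite (Eg _ _ xy) leqnn xy implybT.
split.
- exact: components_equiv.
- apply/compatibleP; split=> [x|x y].
    apply/connected_restrictP=> U hU i j; rewrite !inE => xi xj.
    pose O := U :&: [set y | le E x y].
    have OU z : le E x z -> (z \in O) = (z \in U) by move=> xz; rewrite !inE xz andbT.
    rewrite -!OU //; have ij : le E i j by apply: le_trans xj; rewrite components_sym.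
    apply: (componentsP _ _ _ ij); apply/clopenP=> a b ab; rewrite !inE.
    have /le_components Eab := ab; have Eba : le E b a by rewrite components_sym.
    case xa: (le E x a); last first.
      by case xb: (le E x b); rewrite ?andbF //; rewrite (le_trans xb Eba) in xa.
    have xb := le_trans xa Eab; rewrite xb !andbT.
    by apply: hU; rewrite ?inE //; move: ab; rewrite le_inter => /andP[].
  apply/andP/idP=> [[/con/andP[xy /implyP h] /con/andP[yx _]]|xy].
    by apply: h; rewrite -val_eqE eqn_leq xy yx.
  by split; apply: contract_equiv; rewrite // components_sym.
- apply/LstrP; split; first by apply/monotoneP=> i j /con/andP[].
  move=> x y /con/andP[_ /implyP h] e; apply: contract_equiv.
  by rewrite components_sym; apply: h; rewrite e.
- apply: quasiPoset_ext => x y; rewrite !le_inter le_kernel.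
  by case xy: (le P x y) => //=; apply/idP/eqP=> [/Eg|/(PE _ _ xy)].
Qed.

Section Sums.
Variables (K : fieldType) (w : qp -> K).

(** The pairs [E <| P] with a strict map on [P / E] are the monotone maps [g]
    on [P]: the classes of [E] are the components of the fibres of [g]. *)
Lemma sum_strict (A : finType) (P : quasiPoset A) k :
  \sum_(E : quasiPoset A | is_equiv E && compatible E P)
    #|Lstr (contract P E) k|%:R * w (isoclass (inter P E))
  = \sum_(g in monotone P k) w (isoclass (inter P (kernel g))).
Proof.
under eq_bigr => E _ do rewrite -sum1_card natr_sum mulr_suml.
rewrite (exchange_big_dep (mem (monotone P k))) /=; last first.
  by move=> E g /andP[Ee Ec] gL; case: (compatible_strict Ee Ec gL).
apply: eq_bigr => g gm; have [Ee Ec gL PE] := strict_compatible gm.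
rewrite (big_pred1 (components (inter P (kernel g)))) ?PE ?mul1r // => E /=.
apply/andP/eqP=> [[/andP[Fe Fc] gF]|->]; last by rewrite Ee Ec.
by case: (compatible_strict Fe Fc gF).
Qed.

Hypothesis w1 : w mone = 1.
Hypothesis wM : forall c d, w (mmul c d) = w c * w d.

(** [P] without the relations between distinct fibres is the disjoint union
    of the restrictions of [P] to the fibres. *)
Lemma prod_fibres (A : finType) (P : quasiPoset A) k (f : {ffun A -> 'I_k}) :
  \prod_(i < k) w (isoclass (restrict P (fibre f i)))
  = w (isoclass (inter P (kernel f))).
Proof.
(* Fibres are added one at a time, as parts unrelated to the previous ones. *)
suff h (r : seq 'I_k) : uniq r ->
    \prod_(i <- r) w (isoclass (restrict P (fibre f i)))
    = w (isoclass (restrict (inter P (kernel f)) [set x | f x \in r])).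
  rewrite h ?index_enum_uniq // -[in RHS]isoclass_restrictT.
  congr (w (isoclass (restrict _ _))); apply/setP=> x.
  by rewrite !inE mem_index_enum.
elim: r => [_|i r IH /= /andP[ir ur]].
  rewrite big_nil isoclass_empty ?w1 // card_sig.
  by apply: eq_card0 => x; rewrite !inE.
rewrite big_cons IH // (_ : [set x | f x \in i :: r] = fibre f i :|: [set x | f x \in r]).
  rewrite isoclass_restrictU ?wM; first 1 last.
  - rewrite -setI_eq0; apply/eqP/setP=> x; rewrite !inE.
    by apply/negP=> /andP[/eqP->]; apply/negP.
  - move=> x y; rewrite in_fibre inE => /eqP xi yr.
    rewrite !le_inter !le_kernel xi (_ : (i == f y) = false) 1?eq_sym ?andbF //.
      rewrite (_ : (i == f y) = false) ?andbF //; apply/negP=> /eqP e.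
      by move: ir; rewrite e yr.
    by apply/negP=> /eqP e; move: ir; rewrite -e yr.
  congr (w (isoclass _) * _); apply: restrict_eq => x y.
  by rewrite !in_fibre le_inter le_kernel => /eqP-> /eqP->; rewrite eqxx andbT.
by apply/setP=> x; rewrite !inE.
Qed.

(** The identity behind every use of [delta]: [ehr_str <- w] is the Hopf
    morphism attached to the character [w]. *)
Lemma fibre_sum_delta (A : finType) (P : quasiPoset A) k :
  \sum_(E : quasiPoset A | is_equiv E && compatible E P)
    #|Lstr (contract P E) k|%:R * w (isoclass (inter P E))
  = fibre_sum w k P.
Proof.
rewrite sum_strict /fibre_sum; apply: eq_bigr => g _.
by rewrite prod_fibres.
Qed.

End Sums.

(** Splitting along a proper clopen set until none is left; multiplicative
    statements are thereby reduced to the connected case. *)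
Lemma connected_ind (T : qp -> Prop) :
  T mone ->
  (forall (A : finType) (P : quasiPoset A), (0 < #|A|)%N -> connected P ->
     T (isoclass P)) ->
  (forall c d, T c -> T d -> T (mmul c d)) -> forall c, T c.
Proof.
move=> T1 Tc TM c; rewrite -(isoclass_qrep c).
suff h n (A : finType) (P : quasiPoset A) : (#|A| <= n)%N -> T (isoclass P).
  exact: h (leqnn _).
elim: n A P => [|n IH] A P le.
  by rewrite isoclass_empty //; apply/eqP; rewrite -leqn0.
have [A0|A0] := posnP #|A|; first by rewrite isoclass_empty.
case: (boolP (connected P)) => [/Tc|]; first exact.
move=> /forall_inPn[O Oo]; rewrite negb_imply => /andP[Oo' /norP[n0 nT]].
have OP : O \in clopen P by rewrite inE Oo.
rewrite -isoclass_restrictT -(setUCr O) isoclass_restrictU.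
- have lt (S : {set A}) : S != setT -> (#|{: {x | x \in S}}| <= n)%N.
    move=> ne; rewrite card_sig -ltnS (leq_trans _ le) // -cardsT.
    by apply: proper_card; rewrite properT.
  apply: TM; apply: IH; apply: lt => //.
  by apply: contraNneq n0 => e; rewrite -[O]setCK e setCT.
- by rewrite -setI_eq0 setICr.
- move=> x y xO; rewrite inE => yO.
  by apply/andP; split; apply/negP=> /(clopenP _ _ OP); rewrite xO (negbTE yO).
Qed.

End Components.
(** * Numbers of classes and of components *)

Section ComponentCount.

Lemma cl1P (A : finType) (P : quasiPoset A) :
  reflect ((0 < #|A|)%N /\ forall x y, le P x y) (cl P == 1%N).
Proof.
apply: (iffP cards1P) => [[S e]|[/card_gt0P[x0 _] h]].
  have E x : [set y | sim P x y] = S by apply/set1P; rewrite -e imset_f.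
  split.
    have /imsetP[x _ _] : S \in [set [set y | sim P x y] | x : A] by rewrite e set11.
    by apply/card_gt0P; exists x.
  by move=> x y; have /eqP := etrans (E x) (esym (E y)); rewrite sim_class_eq => /andP[].
exists [set: A]; apply/setP=> S; rewrite inE; apply/imsetP/eqP=> [[x _ ->]|->].
  by apply/setP=> y; rewrite !inE /sim !h.
by exists x0 => //; apply/setP=> y; rewrite !inE /sim !h.
Qed.

Lemma cl_gt0 (A : finType) (P : quasiPoset A) : (0 < #|A|)%N -> (0 < cl P)%N.
Proof.
case/card_gt0P=> x _; apply/card_gt0P; exists [set y | sim P x y].
exact: imset_f.
Qed.

Lemma cl_empty (A : finType) (P : quasiPoset A) : #|A| = 0%N -> cl P = 0%N.
Proof.
by move=> A0; apply/eqP; rewrite -leqn0 -A0 leq_imset_card.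
Qed.

Definition ncomp (A : finType) (P : quasiPoset A) : nat := cl (components P).

Lemma ncomp_empty (A : finType) (P : quasiPoset A) : #|A| = 0%N -> ncomp P = 0%N.
Proof. exact: cl_empty. Qed.

Lemma ncomp_connected (A : finType) (P : quasiPoset A) :
  (0 < #|A|)%N -> connected P -> ncomp P = 1%N.
Proof. by move=> A0 /connected_componentsP h; apply/eqP/cl1P. Qed.

(** The classes of [E] being connected, a clopen set of [P] cannot cut them. *)
Lemma clopen_contract (A : finType) (P E : quasiPoset A) :
  is_equiv E -> compatible E P -> clopen (contract P E) = clopen P.
Proof.
move=> /is_equivP Es /compatibleP[Ec _]; apply/setP=> O.
apply/clopenP/clopenP=> h i j; first by move=> ij; apply: h; apply: contract_le.
move=> ij; apply/eqP; move: i j ij.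
apply: (contract_ind (R := fun i j => (i \in O) == (j \in O))) => //.
- by move=> j i k /eqP->.
- by move=> i j /h->.
- move=> i j ij; apply/eqP.
  move/connected_restrictP: (Ec i) => /(_ O); apply; rewrite ?inE ?le_refl //.
  by move=> a b _ _; apply: h.
Qed.

Lemma components_contract (A : finType) (P E : quasiPoset A) :
  is_equiv E -> compatible E P -> components (contract P E) = components P.
Proof.
move=> Ee Ec; apply: quasiPoset_ext => x y.
by apply/componentsP/componentsP; rewrite clopen_contract.
Qed.

Lemma components_iso (A B : finType) (P : quasiPoset A) (Q : quasiPoset B) :
  isomorphic P Q -> isomorphic (components P) (components Q).
Proof.
case=> f [g fK gK] h; exists f; first by exists g.
move=> x y; apply/componentsP/componentsP=> H O /clopenP Oc.
  have := H (g @^-1: O); rewrite ![_ \in g @^-1: O]in_set !fK; apply.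
  apply/clopenP=> i j; rewrite -[i]gK -[j]gK h !in_set !fK; exact: Oc.
have := H (f @^-1: O); rewrite ![_ \in f @^-1: O]in_set; apply.
by apply/clopenP=> i j; rewrite -h !in_set; apply: Oc.
Qed.

Lemma components_qsum (A B : finType) (P : quasiPoset A) (Q : quasiPoset B) :
  components (qsum P Q) = qsum (components P) (components Q).
Proof.
have Ocl : [set inr y | y : B] \in clopen (qsum P Q).
  apply/clopenP=> -[i|i] [j|j]; rewrite le_mkQP //= => _; last by rewrite !imset_f.
  by apply/imsetP/imsetP=> -[].
have inlN x : (inl x \in [set inr y | y : B]) = false :> bool by apply/imsetP=> -[].
apply: quasiPoset_ext => -[x|x] [y|y]; rewrite [RHS]le_mkQP /=.
- apply/componentsP/componentsP=> h O /clopenP Oc.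
    have := h [set u : A + B | if u is inl x then x \in O else false].
    rewrite [inl x \in _]in_set [inl y \in _]in_set; apply.
    by apply/clopenP=> -[i|i] [j|j]; rewrite le_mkQP /= ?in_set // => /Oc.
  have := h [set z | inl z \in O]; rewrite [x \in _]in_set [y \in _]in_set; apply.
  by apply/clopenP=> i j ij; rewrite !in_set; apply: Oc; rewrite le_mkQP.
- by apply/componentsP=> /(_ _ Ocl); rewrite inlN imset_f.
- by apply/componentsP=> /(_ _ Ocl); rewrite inlN imset_f.
- apply/componentsP/componentsP=> h O /clopenP Oc.
    have := h [set u : A + B | if u is inr x then x \in O else false].
    rewrite [inr x \in _]in_set [inr y \in _]in_set; apply.
    by apply/clopenP=> -[i|i] [j|j]; rewrite le_mkQP /= ?in_set // => /Oc.
  have := h [set z | inr z \in O]; rewrite [x \in _]in_set [y \in _]in_set; apply.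
  by apply/clopenP=> i j ij; rewrite !in_set; apply: Oc; rewrite le_mkQP.
Qed.

Lemma ncomp_iso (A B : finType) (P : quasiPoset A) (Q : quasiPoset B) :
  isomorphic P Q -> ncomp P = ncomp Q.
Proof. by move/components_iso/cl_iso. Qed.

Lemma ncomp_qsum (A B : finType) (P : quasiPoset A) (Q : quasiPoset B) :
  ncomp (qsum P Q) = (ncomp P + ncomp Q)%N.
Proof. by rewrite /ncomp components_qsum cl_qsum. Qed.

Lemma ncomp_contract (A : finType) (P E : quasiPoset A) :
  is_equiv E -> compatible E P -> ncomp (contract P E) = ncomp P.
Proof. by move=> Ee Ec; rewrite /ncomp components_contract. Qed.

Lemma ncomp_qrep (A : finType) (P : quasiPoset A) :
  ncomp (qrep (isoclass P)) = ncomp P.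
Proof. exact/ncomp_iso/qrep_isoclass. Qed.

Lemma mmul_qrep c d : mmul c d = isoclass (qsum (qrep c) (qrep d)).
Proof. by rewrite -mul_isoclass !isoclass_qrep. Qed.

Lemma cl_mul c d : cl (qrep (mmul c d)) = (cl (qrep c) + cl (qrep d))%N.
Proof.
by rewrite (congr1 (fun e => cl (qrep e)) (mmul_qrep c d)) cl_qrep cl_qsum.
Qed.

Lemma ncomp_mul c d :
  ncomp (qrep (mmul c d)) = (ncomp (qrep c) + ncomp (qrep d))%N.
Proof.
by rewrite (congr1 (fun e => ncomp (qrep e)) (mmul_qrep c d)) ncomp_qrep ncomp_qsum.
Qed.

Lemma discrete_mul c d :
  discrete (qrep (mmul c d)) = discrete (qrep c) && discrete (qrep d).
Proof.
rewrite (congr1 (fun e => discrete (qrep e)) (mmul_qrep c d)).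
rewrite (discrete_iso (qrep_isoclass _)).
apply/discreteP/andP=> [h|[/discreteP hc /discreteP hd]].
  by split; apply/discreteP=> x y;
    [have := h (inl x) (inl y)|have := h (inr x) (inr y)]; rewrite !le_mkQP.
by move=> [x|x] [y|y]; rewrite !le_mkQP //=; [apply: hc|apply: hd].
Qed.

Lemma card_one : #|'I_(tag (repr (mone : qp) : qp_rep))| = 0%N.
Proof. by apply/eqP; rewrite -(isoclass_eq1 (qrep mone)) isoclass_qrep. Qed.

Lemma discrete_connected (A : finType) (P : quasiPoset A) :
  connected P -> discrete P -> forall x y, le P x y.
Proof.
move=> /connected_componentsP con /discreteP d x y.
have := componentsP _ _ _ (con x y) [set z | le P x z].
rewrite [x \in _]inE [y \in _]inE le_refl => <- //; apply/clopenP=> i j ij.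
by rewrite !inE; apply/idP/idP=> h; apply: le_trans h _; last apply: d.
Qed.

(** A component is a union of classes, so equality of the numbers means that
    each component is a single class. *)
Lemma ncomp_leqif_cl c :
  (ncomp (qrep c) <= cl (qrep c) ?= iff discrete (qrep c))%N.
Proof.
elim/connected_ind: c => [|A P A0 con|c d].
- rewrite ncomp_empty ?cl_empty ?card_one //; split=> //; symmetry.
  by apply/discreteP=> x; have := card0_eq card_one x; rewrite inE.
- rewrite ncomp_qrep cl_qrep (discrete_iso (qrep_isoclass _)) ncomp_connected //.
  split; first exact: cl_gt0.
  rewrite eq_sym; apply/cl1P/discreteP=> [[_ h] //|/discreteP d].
  by split=> //; apply: discrete_connected.
- by rewrite ncomp_mul cl_mul discrete_mul; apply: leqif_add.
Qed.

End ComponentCount.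

(** * Morphisms given by their values on the basis *)

Section Morphisms.
Variable K : fieldType.

Lemma linear_comp (U V W : lmodType K) (f : U -> V) (g : V -> W) :
  linear f -> linear g -> linear (fun x => g (f x)).
Proof. by move=> lf lg a x y /=; rewrite lf lg. Qed.

Lemma horner_linear (x : K) : linear (fun p : {poly K} => p.[x] : K^o).
Proof. by move=> a p q; rewrite hornerD hornerZ. Qed.

Lemma alg_mor_linext (B : algType K) (f : qp -> B) :
  f mone = 1 -> (forall c d, f (mmul c d) = f c * f d) ->
  alg_mor (linext f : Hqp K -> B).
Proof.
move=> f1 fM; have lf := linext_linear f; split=> //.
split=> [|x y]; first by rewrite linextU.
pose F := linext f; rewrite -![linext f _]/(F _).
move: x; apply: linear_malg_ext => [a x z|a x z|c].
- by rewrite mulrDl -scalerAl; apply: lf.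
- by rewrite [F (_ + _)]lf mulrDl -scalerAl.
move: y; apply: linear_malg_ext => [a x z|a x z|d].
- by rewrite mulrDr -scalerAr; apply: lf.
- by rewrite [F (_ + _)]lf mulrDr -scalerAr.
have -> : (<< c >> : Hqp K) * << d >> = << mmul c d >>.
  by rewrite [LHS]malgM_def fgmulUU mulr1.
by rewrite /F !linextU fM.
Qed.

End Morphisms.
Section MorphismsOnBasis.
Variables (K : fieldType) (char0 : [pchar K] =i pred0).
Implicit Types phi psi : Hqp K -> {poly K}.

Lemma horner_XaY (p : {poly K}) x y : (poly_XaY p).[x, y] = p.[x + y].
Proof. by rewrite horner_poly_XaY horner_comp !hornerE. Qed.

Lemma horner_XmY (p : {poly K}) x y : (poly_XmY p).[x, y] = p.[x * y].
Proof. by rewrite horner_poly_XmY horner_comp !hornerE. Qed.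

Lemma horner_tensor_map phi psi (u : Hqp2 K) x y :
  (tensor_map phi psi u).[x, y] =
  linext (fun cd => (phi << cd.1 >>).[x] * (psi << cd.2 >>).[y] : K^o) u.
Proof.
rewrite /tensor_map mmapE /linext !horner_sum; apply: eq_bigr => -[c d] _ /=.
by rewrite !(hornerM, hornerC, horner_map).
Qed.

Lemma linext_sum (T : choiceType) (V : lmodType K) (f : T -> V) (I : finType)
    (P : pred I) (F : I -> T) :
  linext f (\sum_(i | P i) << F i >>) = \sum_(i | P i) f (F i).
Proof. by rewrite raddf_sum; apply: eq_bigr => i _; apply: linextU. Qed.

Lemma linext_Delta (V : lmodType K) (F : qp * qp -> V) (A : finType)
    (P : quasiPoset A) :
  linext F (Delta (<< isoclass P >> : Hqp K)) =
  \sum_(O in opens P) F (isoclass (restrict P (~: O)), isoclass (restrict P O)).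
Proof.
rewrite /Delta linextU linext_sum.
exact: (opens_iso_sum (fun c d => F (c, d)) (qrep_isoclass P)).
Qed.

Lemma linext_delta (V : lmodType K) (F : qp * qp -> V) (c : qp) :
  linext F (delta (<< c >> : Hqp K)) =
  \sum_(E : quasiPoset _ | is_equiv E && compatible E (qrep c))
    F (isoclass (contract (qrep c) E), isoclass (inter (qrep c) E)).
Proof. by rewrite /delta linextU linext_sum. Qed.

Lemma hopf_horner phi : hopf_mor phi ->
  forall (A : finType) (P : quasiPoset A) x y,
  (phi << isoclass P >>).[x + y] =
  \sum_(O in opens P) (phi << isoclass (restrict P (~: O)) >>).[x]
                      * (phi << isoclass (restrict P O) >>).[y].
Proof.
by case=> _ h _ A P x y; rewrite -horner_XaY h horner_tensor_map linext_Delta.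
Qed.

Lemma eps_linear : linear (@eps K : Hqp K -> K^o).
Proof. by move=> a x y; rewrite /eps mcoeffD mcoeffZ. Qed.

Lemma Delta_linear : linear (@Delta K).
Proof. exact: linext_linear. Qed.

Lemma delta_linear : linear (@delta K).
Proof. exact: linext_linear. Qed.

Lemma hopf_morI (f : qp -> {poly K}) :
  f mone = 1 -> (forall c d, f (mmul c d) = f c * f d) ->
  (forall c, (f c).[0] = (c == mone)%:R) ->
  (forall (A : finType) (P : quasiPoset A) (k l : nat),
     (f (isoclass P)).[(k + l)%:R] =
     \sum_(O in opens P) (f (isoclass (restrict P (~: O)))).[k%:R]
                         * (f (isoclass (restrict P O))).[l%:R]) ->
  hopf_mor (linext f : Hqp K -> {poly K}).
Proof.
move=> f1 fM f0 fD; have lf := linext_linear f.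
split=> [|x|]; first exact: alg_mor_linext.
  apply: (natr_polyXY char0) => k l; rewrite horner_XaY horner_tensor_map.
  move: x; apply: (linear_malg_ext (V := K^o)).
  - exact: linear_comp lf (horner_linear _).
  - exact: linear_comp Delta_linear (linext_linear _).
  move=> c; rewrite linextU -[c]isoclass_qrep -natrD fD linext_Delta.
  by apply: eq_bigr => O _; rewrite !linextU.
apply: (linear_malg_ext (V := K^o)).
- exact: linear_comp lf (horner_linear _).
- exact: eps_linear.
by move=> c; rewrite linextU f0 /eps mcoeffU1.
Qed.

Lemma bialg_morI (f : qp -> {poly K}) :
  f mone = 1 -> (forall c d, f (mmul c d) = f c * f d) ->
  (forall c, (f c).[1] = (discrete (qrep c))%:R) ->
  (forall c (k l : nat),
     (f c).[(k * l)%:R] =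
     \sum_(E : quasiPoset _ | is_equiv E && compatible E (qrep c))
       (f (isoclass (contract (qrep c) E))).[k%:R]
       * (f (isoclass (inter (qrep c) E))).[l%:R]) ->
  bialg_mor (linext f : Hqp K -> {poly K}).
Proof.
move=> f1 fM fe fD; have lf := linext_linear f.
split=> [|x|]; first exact: alg_mor_linext.
  apply: (natr_polyXY char0) => k l; rewrite horner_XmY horner_tensor_map.
  move: x; apply: (linear_malg_ext (V := K^o)).
  - exact: linear_comp lf (horner_linear _).
  - exact: linear_comp delta_linear (linext_linear _).
  move=> c; rewrite linextU -natrM fD linext_delta.
  by apply: eq_bigr => O _; rewrite !linextU.
apply: (linear_malg_ext (V := K^o)).
- exact: linear_comp lf (horner_linear _).
- exact: linext_linear.
by move=> c; rewrite linextU fe /eps' linextU.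
Qed.

(** The recursion in [k] is [phi_P (X + Y)] evaluated at [X = k] and [Y = 1]. *)
Lemma hopf_fibre_sum phi : hopf_mor phi ->
  forall (A : finType) (P : quasiPoset A) (k : nat),
  (phi << isoclass P >>).[k%:R] = fibre_sum (fun c => (phi << c >>).[1]) k P.
Proof.
move=> h A P k; apply: (fibre_sum_unique (F := fun k c => (phi << c >>).[k%:R])).
  by case: (h) => _ _ h0 c; rewrite h0 /eps mcoeffU1.
by move=> j B Q; rewrite -addn1 natrD hopf_horner.
Qed.

(** The coefficient of [Y] in [phi_P (X + Y)]. *)
Lemma hopf_deriv phi : hopf_mor phi ->
  forall (A : finType) (P : quasiPoset A),
  (phi << isoclass P >>)^`() =
  \sum_(O in opens P) (phi << isoclass (restrict P O) >>)`_1
                      *: phi << isoclass (restrict P (~: O)) >>.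
Proof.
move=> h A P; apply: (natr_polyK char0) => k; set x : K := k.+1%:R.
(* The coefficient of [Y] in [p (x + Y)] is the derivative of [p] at [x]. *)
have coef1 (p : {poly K}) : p`_1 = p^`().[0].
  by rewrite horner_coef0 coef_deriv mulr1n.
have sh (p : {poly K}) : p^`().[x] = (p \Po (x%:P + 'X))`_1.
  by rewrite coef1 deriv_comp derivD derivC derivX add0r mulr1 horner_comp !hornerE.
rewrite sh (_ : _ \Po _ = \sum_(O in opens P)
    (phi << isoclass (restrict P (~: O)) >>).[x] *: phi << isoclass (restrict P O) >>).
  by rewrite coef_sum horner_sum; apply: eq_bigr => O _; rewrite coefZ hornerZ mulrC.
apply: (natr_polyK char0) => l; rewrite horner_comp horner_sum !hornerE hopf_horner //.
by apply: eq_bigr => O _; rewrite hornerZ.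
Qed.

(** The infinitesimal version of [hopf_fibre_sum]: iterating [hopf_deriv]
    expresses [phi] by its linear coefficients. *)
Lemma hopf_coef phi : hopf_mor phi ->
  forall (A : finType) (P : quasiPoset A) (m : nat),
  (phi << isoclass P >>)`_m *+ m`! = fibre_sum (fun c => (phi << c >>)`_1) m P.
Proof.
move=> h A P m; apply: (fibre_sum_unique (F := fun m c => (phi << c >>)`_m *+ m`!)).
  by case: (h) => _ _ h0 c; rewrite -horner_coef0 h0 /eps mcoeffU1 mulr1n.
move=> j B Q; rewrite factS mulrnA -coef_deriv hopf_deriv // coef_sum -sumrMnl.
by apply: eq_bigr => O _; rewrite coefZ mulrnAl mulrC.
Qed.

End MorphismsOnBasis.
(** * The strict Ehrhart polynomial *)

Section Ehrhart.
Variables (K : fieldType) (char0 : [pchar K] =i pred0).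

Let disc (c : qp) : K := (discrete (qrep c))%:R.

Lemma ehr_str_polyP (A : finType) (P : quasiPoset A) (p : {poly K}) :
  (forall k : nat, p.[k.+1%:R] = #|Lstr P k.+1|%:R) -> ehr_str_poly K P = p.
Proof.
move=> h; apply: (natr_polyK char0) => k; rewrite h /ehr_str_poly.
apply: (epsilon_spec (inhabits 0) (fun q : {poly K} =>
  forall k : nat, (1 <= k)%N -> q.[k%:R] = #|Lstr P k|%:R)) => //.
by exists p => -[].
Qed.

Lemma leq_card_Lstr (A B : finType) (P : quasiPoset A) (Q : quasiPoset B) k :
  isomorphic P Q -> (#|Lstr Q k| <= #|Lstr P k|)%N.
Proof.
case=> f [g fK gK] h; pose F (u : {ffun B -> 'I_k}) := [ffun x => u (f x)].
have Fi : injective F.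
  by move=> u v /ffunP e; apply/ffunP=> y; have := e (g y); rewrite !ffunE gK.
rewrite -(card_imset _ Fi); apply/subset_leq_card/subsetP=> _ /imsetP[u + ->].
case/LstrP=> /monotoneP um us; apply/LstrP; split.
  by apply/monotoneP=> i j; rewrite !ffunE -h; apply: um.
by move=> x y; rewrite !ffunE -!h; apply: us.
Qed.

Lemma card_Lstr_iso (A B : finType) (P : quasiPoset A) (Q : quasiPoset B) k :
  isomorphic P Q -> #|Lstr Q k| = #|Lstr P k|.
Proof.
by move=> h; apply/eqP; rewrite eqn_leq !leq_card_Lstr //; apply: isomorphic_sym.
Qed.

Lemma card_LstrD (A : finType) (P : quasiPoset A) k l :
  #|Lstr P (k + l)|%:R = \sum_(O in opens P)
    #|Lstr (restrict P (~: O)) k|%:R * #|Lstr (restrict P O) l|%:R :> K.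
Proof.
by rewrite card_Lstr fibre_sumD; apply: eq_bigr => O _; rewrite !card_Lstr.
Qed.

(** The difference [L_P (k + 1) - L_P (k)] is the sum, over the nonempty open
    sets [O] that may carry the largest value, of [L] for the complement; it is
    a polynomial of degree less than [cl P] by induction. *)
Lemma ehr_str_poly_spec (A : finType) (P : quasiPoset A) :
  (size (ehr_str_poly K P) <= (cl P).+1)%N /\
  forall k : nat, (ehr_str_poly K P).[k%:R] = #|Lstr P k|%:R.
Proof.
have [n] := ubnP #|A|; elim: n A P => // n IH A P; rewrite ltnS => An.
have {}IH (O : {set A}) : O != set0 ->
    (size (ehr_str_poly K (restrict P (~: O))) <= (cl (restrict P (~: O))).+1)%N /\
    forall k : nat, (ehr_str_poly K (restrict P (~: O))).[k%:R]
      = #|Lstr (restrict P (~: O)) k|%:R.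
  move=> O0; apply: IH; rewrite card_sig; apply: leq_trans An.
  rewrite -cardsT; apply: proper_card; rewrite properT.
  by apply: contraNneq O0 => e; rewrite -[O]setCK e setCT.
pose q : {poly K} := \sum_(O in opens P | O != set0)
  disc (isoclass (restrict P O)) *: ehr_str_poly K (restrict P (~: O)).
have L1 (B : finType) (Q : quasiPoset B) : #|Lstr Q 1|%:R = disc (isoclass Q).
  by rewrite card_Lstr fibre_sum1.
(* The term of [O = set0] is [L_P (k)] itself. *)
have LS k : #|Lstr P k.+1|%:R = #|Lstr P k|%:R + q.[k%:R] :> K.
  rewrite -addn1 card_LstrD (bigD1 set0) /=; last first.
    by apply/opensP=> i j; rewrite inE.
  congr (_ + _).
    rewrite L1 [disc _](_ : _ = 1) ?mulr1.
      by congr (_%:R); apply/card_Lstr_iso/isoclassP; rewrite setC0 isoclass_restrictT.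
    rewrite /disc (discrete_iso (qrep_isoclass _)) (introT (discreteP _)) // => x.
    by have := valP x; rewrite inE.
  rewrite /q horner_sum; apply: eq_bigr => O /andP[_ O0].
  by rewrite hornerZ L1 (IH O O0).2 mulrC.
have sq : (size q <= cl P)%N.
  apply: leq_trans (size_sum _ _ _) _; apply/bigmax_leqP=> O /andP[Oo O0].
  apply: leq_trans (size_scale_leq _ _) _; apply: leq_trans (IH O O0).1 _.
  rewrite (cl_open Oo) -addn1 leq_add2l cl_gt0 // card_sig.
  by rewrite card_gt0.
have [p [sp p0 pE]] := antidifference char0 sq.
pose p' := p + (#|Lstr P 0|%:R)%:P.
have p'E (k : nat) : p'.[k%:R] = #|Lstr P k|%:R.
  elim: k => [|k IHk]; first by rewrite hornerD hornerC p0 add0r.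
  rewrite LS -IHk -pE -addn1 natrD /p' !hornerD !hornerC.
  by rewrite [RHS]addrC addrA subrK.
rewrite (@ehr_str_polyP _ _ p') //; split=> //.
rewrite (leq_trans (size_polyD _ _)) // geq_max sp.
by rewrite (leq_trans (size_polyC_leq1 _)).
Qed.

Lemma size_ehr_str_poly (A : finType) (P : quasiPoset A) :
  (size (ehr_str_poly K P) <= (cl P).+1)%N.
Proof. by case: (ehr_str_poly_spec P). Qed.

Lemma horner_ehr (A : finType) (P : quasiPoset A) (k : nat) :
  (ehr_str_poly K P).[k%:R] = #|Lstr P k|%:R.
Proof. by case: (ehr_str_poly_spec P). Qed.

Definition ehr (c : qp) : {poly K} := ehr_str_poly K (qrep c).

Lemma ehr_isoclass (A : finType) (P : quasiPoset A) :
  ehr (isoclass P) = ehr_str_poly K P.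
Proof.
apply: ehr_str_polyP => k; rewrite horner_ehr.
by congr (_%:R); apply/card_Lstr_iso/qrep_isoclass.
Qed.

Lemma ehr_strU c : ehr_str K << c >> = ehr c.
Proof. exact: linextU. Qed.

Lemma card_Lstr_qsum (A B : finType) (P : quasiPoset A) (Q : quasiPoset B) k :
  #|Lstr (qsum P Q) k| = (#|Lstr P k| * #|Lstr Q k|)%N.
Proof.
pose F (u : {ffun A -> 'I_k} * {ffun B -> 'I_k}) : {ffun A + B -> 'I_k} :=
  [ffun z => match z with inl x => u.1 x | inr y => u.2 y end].
have Fi : injective F.
  move=> [u u'] [v v'] /ffunP e; congr (_, _); apply/ffunP=> x.
    by have := e (inl x); rewrite !ffunE.
  by have := e (inr x); rewrite !ffunE.
rewrite -cardsX -(card_imset _ Fi); congr #|pred_of_set _|.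
apply/setP=> f; apply/LstrP/imsetP=> [[/monotoneP fm fs]|[[u v]]].
  exists ([ffun x => f (inl x)], [ffun y => f (inr y)]); last first.
    by apply/ffunP=> -[x|y]; rewrite !ffunE.
  rewrite inE /=; apply/andP; split; apply/LstrP; split.
  - by apply/monotoneP=> i j ij; rewrite !ffunE fm // le_mkQP.
  - move=> x y xy; rewrite !ffunE => e.
    by have := fs (inl x) (inl y); rewrite !le_mkQP; apply.
  - by apply/monotoneP=> i j ij; rewrite !ffunE fm // le_mkQP.
  - move=> x y xy; rewrite !ffunE => e.
    by have := fs (inr x) (inr y); rewrite !le_mkQP; apply.
rewrite inE /= => /andP[/LstrP[/monotoneP um us] /LstrP[/monotoneP vm vs]] ->.
split; first by apply/monotoneP=> -[i|i] [j|j]; rewrite le_mkQP //= !ffunE; [apply: um|apply: vm].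
by move=> [x|x] [y|y]; rewrite !le_mkQP //= !ffunE; [apply: us|apply: vs].
Qed.

Lemma ehr_mul c d : ehr (mmul c d) = ehr c * ehr d.
Proof.
rewrite mmul_qrep ehr_isoclass; apply: ehr_str_polyP => k.
by rewrite hornerM !horner_ehr card_Lstr_qsum natrM.
Qed.

Lemma ehr0 c : (ehr c).[0] = (c == mone)%:R.
Proof.
by rewrite [0](_ : _ = 0%:R) // horner_ehr card_Lstr fibre_sum0 isoclass_qrep.
Qed.

Lemma ehr_one : ehr mone = 1.
Proof.
rewrite [LHS]size1_polyC -?horner_coef0 ?ehr0 ?eqxx //.
by rewrite (leq_trans (size_ehr_str_poly _)) // cl_empty // card_one.
Qed.

Lemma ehr1 c : (ehr c).[1] = disc c.
Proof.
by rewrite [1](_ : _ = 1%:R) // horner_ehr card_Lstr fibre_sum1 isoclass_qrep.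
Qed.

Lemma ehrD (A : finType) (P : quasiPoset A) (k l : nat) :
  (ehr (isoclass P)).[(k + l)%:R] =
  \sum_(O in opens P) (ehr (isoclass (restrict P (~: O)))).[k%:R]
                      * (ehr (isoclass (restrict P O))).[l%:R].
Proof.
rewrite ehr_isoclass horner_ehr card_LstrD; apply: eq_bigr => O _.
by rewrite !ehr_isoclass !horner_ehr.
Qed.

Lemma ehr_hopf : hopf_mor (ehr_str K).
Proof.
apply: (hopf_morI char0); [exact: ehr_one|exact: ehr_mul|exact: ehr0|exact: ehrD].
Qed.

(** For fixed [l], both [ehr_P (k l)] and the sum over [E <| P] are the fibre
    sum of the character [ehr(.)(l)]. *)
Lemma ehr_delta c (k l : nat) :
  (ehr c).[(k * l)%:R] =
  \sum_(E : quasiPoset _ | is_equiv E && compatible E (qrep c))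
    (ehr (isoclass (contract (qrep c) E))).[k%:R]
    * (ehr (isoclass (inter (qrep c) E))).[l%:R].
Proof.
under eq_bigr => E _ do rewrite (ehr_isoclass (contract _ _)) horner_ehr.
rewrite (fibre_sum_delta (w := fun d => (ehr d).[l%:R])); first 1 last.
- by rewrite ehr_one hornerC.
- by move=> d e; rewrite ehr_mul hornerM.
rewrite -{1}[c]isoclass_qrep.
apply: (fibre_sum_unique (F := fun j d => (ehr d).[(j * l)%:R])) => [d|j A P].
  by rewrite mul0n ehr0.
by rewrite mulSnr ehrD.
Qed.

Lemma ehr_bialg : bialg_mor (ehr_str K).
Proof.
apply: (bialg_morI char0); [exact: ehr_one|exact: ehr_mul|exact: ehr1|exact: ehr_delta].
Qed.

(** Both morphisms have the character [eps'] at [1]. *)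
Lemma ehr_unique (psi : Hqp K -> {poly K}) :
  hopf_mor psi -> bialg_mor psi -> psi =1 ehr_str K.
Proof.
move=> hpsi [[lpsi _] _ e1]; apply: linear_malg_ext => // [|c].
  exact: linext_linear.
rewrite ehr_strU; apply: (natr_polyK char0) => k.
rewrite horner_ehr card_Lstr -[c in psi << c >>]isoclass_qrep hopf_fibre_sum //.
apply: eq_bigr => f _; apply: eq_bigr => i _.
by rewrite e1 /eps' linextU.
Qed.

End Ehrhart.
(** * The homogeneous morphism and its character *)

Section Phi0.
Variables (K : fieldType) (char0 : [pchar K] =i pred0).

Local Notation ehr := (ehr K).

Lemma coefM_top (p q : {poly K}) a b : (size p <= a.+1)%N -> (size q <= b.+1)%N ->
  (p * q)`_(a + b) = p`_a * q`_b.
Proof.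
move=> sp sq; rewrite coefM (bigD1 (Ordinal (leq_addr b a : a < (a + b).+1)%N)) //=.
rewrite addKn big1 ?addr0 // => i; rewrite -val_eqE /= => ne.
have [lt|ge] := ltnP i a.
  rewrite [q`__]nth_default ?mulr0 // (leq_trans sq) //.
  by rewrite ltn_subRL ltn_add2r.
by rewrite nth_default ?mul0r // (leq_trans sp) // ltn_neqAle eq_sym ne.
Qed.

Lemma coef_comp_scaleX (p : {poly K}) (x : K) i : (p \Po (x *: 'X))`_i = p`_i * x ^+ i.
Proof.
rewrite comp_polyE coef_sum.
rewrite (eq_bigr (fun j : 'I_(size p) => p`_j * x ^+ j *+ (i == j))); last first.
  by move=> j _; rewrite coefZ exprZn coefZ coefXn mulrA mulr_natr.
have [lt|ge] := ltnP i (size p).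
  rewrite (bigD1 (Ordinal lt)) //= eqxx big1 ?addr0 // => j.
  by rewrite -val_eqE eq_sym /= => /negbTE->.
rewrite nth_default // mul0r big1 // => j _.
by case: eqP => // e; move: (ltn_ord j); rewrite -e ltnNge ge.
Qed.

Lemma size_comp_scaleX (p : {poly K}) (x : K) : (size (p \Po (x *: 'X)) <= size p)%N.
Proof.
by apply/leq_sizeP=> j le; rewrite coef_comp_scaleX nth_default // mul0r.
Qed.

Let lead (c : qp) : K := (ehr c)`_(cl (qrep c)).

Lemma size_ehr c : (size (ehr c) <= (cl (qrep c)).+1)%N.
Proof. exact: size_ehr_str_poly. Qed.

Lemma cl_one : cl (qrep mone) = 0%N.
Proof. exact/cl_empty/card_one. Qed.

Lemma cl_eq0 c : (cl (qrep c) == 0%N) = (c == mone).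
Proof.
rewrite -[c in RHS]isoclass_qrep isoclass_eq1; apply/eqP/eqP; last exact: cl_empty.
move=> c0; apply/eqP; case: posnP => // /(cl_gt0 (qrep c)).
by rewrite c0.
Qed.

(** Comparing the terms of top total degree in
    [ehr_P (X + Y) = sum_O ehr_(P - O) (X) ehr_O (Y)]. *)
Lemma leadD (A : finType) (P : quasiPoset A) (x y : K) :
  lead (isoclass P) * (x + y) ^+ cl P =
  \sum_(O in opens P)
    lead (isoclass (restrict P (~: O))) * x ^+ cl (restrict P (~: O))
    * (lead (isoclass (restrict P O)) * y ^+ cl (restrict P O)).
Proof.
have E : ehr (isoclass P) \Po ((x + y) *: 'X) = \sum_(O in opens P)
    (ehr (isoclass (restrict P (~: O))) \Po (x *: 'X))
    * (ehr (isoclass (restrict P O)) \Po (y *: 'X)).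
  apply: (natr_polyK char0) => k; rewrite horner_comp horner_sum hornerZ hornerX mulrDl.
  rewrite -!ehr_strU (hopf_horner (ehr_hopf char0)); apply: eq_bigr => O _.
  by rewrite hornerM !horner_comp !hornerZ !hornerX !ehr_strU.
have := congr1 (fun p : {poly K} => p`_(cl P)) E.
rewrite coef_comp_scaleX coef_sum /lead cl_qrep => ->; apply: eq_bigr => O Oo.
rewrite (cl_open Oo) coefM_top ?coef_comp_scaleX ?cl_qrep //.
  by rewrite (leq_trans (size_comp_scaleX _ _)) // (leq_trans (size_ehr _)) ?cl_qrep.
by rewrite (leq_trans (size_comp_scaleX _ _)) // (leq_trans (size_ehr _)) ?cl_qrep.
Qed.

(** The degree is at most [1], and the values at [0] and [1] are [0] and [1]. *)
Lemma ehr_cl1 (A : finType) (P : quasiPoset A) :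
  cl P = 1%N -> ehr (isoclass P) = 'X.
Proof.
move=> c1; have /cl1P[A0 tot] := introT eqP c1.
have s2 : (size (ehr (isoclass P)) <= 2)%N by rewrite (leq_trans (size_ehr _)) // cl_qrep c1.
have e0 : (ehr (isoclass P))`_0 = 0.
  by rewrite -horner_coef0 (ehr0 char0) isoclass_eq1 eqn0Ngt A0.
have e1 : (ehr (isoclass P))`_1 = 1.
  have := ehr1 char0 (isoclass P); rewrite (horner_coef_wide _ s2) !big_ord_recl big_ord0.
  rewrite e0 mul0r add0r expr1n mulr1 addr0 (discrete_iso (qrep_isoclass P)) => ->.
  by rewrite (introT (discreteP _)) // => x y _; apply: tot.
apply/polyP=> -[|[|i]]; rewrite coefX //= nth_default //.
exact: leq_trans s2 _.
Qed.

(** The part of degree [cl P] of [ehr_P] defines such a morphism. *)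
Lemma phi0P : is_phi0 (phi0 K).
Proof.
apply: (epsilon_spec (inhabits (fun=> 0)) (@is_phi0 K)).
pose f c := lead c *: 'X^(cl (qrep c)) : {poly K}.
exists (linext f); split.
- apply: (hopf_morI char0).
  + by rewrite /f /lead cl_one ehr_one // coefC eqxx scale1r.
  + move=> c d; rewrite /f /lead cl_mul ehr_mul // coefM_top ?size_ehr //.
    by rewrite exprD -scalerAl -scalerAr scalerA.
  + move=> c; rewrite /f hornerZ hornerXn expr0n /lead cl_eq0.
    by case: eqP => [->|]; rewrite ?mulr0 // cl_one ehr_one // coefC mulr1.
  + move=> A P k l; rewrite /f hornerZ hornerXn cl_qrep natrD leadD.
    by apply: eq_bigr => O _; rewrite !hornerZ !hornerXn !cl_qrep.
- move=> n x h; exists (\sum_(c <- msupp x) x@_c * lead c).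
  rewrite scaler_suml /linext big_seq [RHS]big_seq; apply: eq_bigr => c cx.
  by rewrite /f h // scalerA.
- move=> n n0; have c1 : cl (indiscrete 'I_n) = 1%N.
    by apply/eqP/cl1P; split=> [|x y]; rewrite ?card_ord // le_mkQP.
  by rewrite linextU /f /lead cl_qrep c1 ehr_cl1 // coefX scale1r.
Qed.

Lemma phi0_hopf : hopf_mor (phi0 K). Proof. by case: phi0P. Qed.

Lemma char_one (l : Hqp K -> K^o) : is_char l -> l << mone >> = 1.
Proof. by case=> _ [l1 _]; rewrite -[RHS]l1. Qed.

Lemma char_mul (l : Hqp K -> K^o) : is_char l ->
  forall c d, l << mmul c d >> = l << c >> * l << d >>.
Proof.
case=> _ [_ lM] c d; rewrite -lM; congr (l _).
by rewrite [RHS]malgM_def fgmulUU mulr1.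
Qed.

Lemma lambda_spec : is_char (lambda K) /\
  forall c, phi0 K << c >> = lambda K << c >> *: 'X^(cl (qrep c)).
Proof.
apply: (epsilon_spec (inhabits (fun=> 0)) (fun l : Hqp K -> K^o => is_char l /\
  forall c, phi0 K << c >> = l << c >> *: 'X^(cl (qrep c)))).
case: phi0P => -[[lphi [phi1 phiM]] _ _] hom _.
exists (fun x => (phi0 K x).[1]); split.
  split; first exact: linear_comp lphi (horner_linear _).
  by split=> [|x y]; rewrite ?phi1 ?phiM ?hornerC ?hornerM.
move=> c; have [d|a ->] := hom (cl (qrep c)) << c >>.
  by rewrite msuppU1 inE => /eqP->.
by rewrite hornerZ hornerXn expr1n mulr1.
Qed.

Lemma lambda_char : is_char (lambda K). Proof. by case: lambda_spec. Qed.

Lemma phi0U c : phi0 K << c >> = lambda K << c >> *: 'X^(cl (qrep c)).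
Proof. by case: lambda_spec. Qed.

Lemma phi0_1 c : (phi0 K << c >>).[1] = lambda K << c >>.
Proof. by rewrite phi0U hornerZ hornerXn expr1n mulr1. Qed.

(** [phi0] is the Hopf morphism attached to the character [lambda], hence it is
    [ehr_str <- lambda]. *)
Lemma phi0_ehr c :
  phi0 K << c >> =
  \sum_(E : quasiPoset _ | is_equiv E && compatible E (qrep c))
    lambda K << isoclass (inter (qrep c) E) >> *: ehr (isoclass (contract (qrep c) E)).
Proof.
apply: (natr_polyK char0) => k.
rewrite -[c in LHS]isoclass_qrep (hopf_fibre_sum phi0_hopf) horner_sum.
under eq_bigr => E _ do rewrite hornerZ ehr_isoclass // horner_ehr // mulrC.
rewrite (fibre_sum_delta (w := fun c => lambda K << c >>)).
- by apply: eq_bigr => f _; apply: eq_bigr => i _; rewrite phi0_1.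
- exact/char_one/lambda_char.
- exact/char_mul/lambda_char.
Qed.

Lemma phi0_cl1 (A : finType) (P : quasiPoset A) :
  cl P = 1%N -> phi0 K << isoclass P >> = 'X.
Proof.
move=> c1; have /cl1P[A0 tot] := introT eqP c1.
have -> : isoclass P = isoclass (indiscrete 'I_#|A|).
  apply/isoclassP; exists enum_rank; first exact: enum_rank_bij.
  by move=> x y; rewrite le_mkQP tot.
by case: phi0P => _ _; apply.
Qed.

Lemma phi0_coef1 (A : finType) (P : quasiPoset A) :
  (phi0 K << isoclass P >>)`_1 = (cl P == 1%N)%:R.
Proof.
case: eqP => [c1|n1]; first by rewrite phi0_cl1 // coefX.
rewrite phi0U cl_qrep coefZ coefXn eq_sym.
by case: eqP => // _; rewrite mulr0.
Qed.

Lemma lambda_discrete c : discrete (qrep c) -> lambda K << c >> = 1.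
Proof.
elim/connected_ind: c => [_|A P A0 con|c d IHc IHd].
- exact/char_one/lambda_char.
- rewrite (discrete_iso (qrep_isoclass _)) => /(discrete_connected con) tot.
  by rewrite -phi0_1 phi0_cl1 ?hornerX //; apply/eqP/cl1P.
- rewrite discrete_mul (char_mul lambda_char) => /andP[/IHc-> /IHd->].
  by rewrite mulr1.
Qed.

End Phi0.
(** * The character of the strict Ehrhart polynomial *)

Section Alpha.
Variables (K : fieldType) (char0 : [pchar K] =i pred0).

Local Notation ehr := (ehr K).

Lemma ncomp1P (A : finType) (P : quasiPoset A) :
  reflect ((0 < #|A|)%N /\ connected P) (ncomp P == 1%N).
Proof.
apply: (iffP (cl1P _)) => [[A0 h]|[A0 /connected_componentsP h]]; split=> //.
exact/connected_componentsP.
Qed.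

Lemma ncomp_one : ncomp (qrep mone) = 0%N.
Proof. exact/ncomp_empty/card_one. Qed.

(** [ehr_P] vanishes at [0] when [P] is connected and nonempty; the general
    case follows by multiplicativity. *)
Lemma ehr_factor c : exists q, ehr c = q * 'X^(ncomp (qrep c)).
Proof.
elim/connected_ind: c => [|A P A0 con|c d [q eq] [r er]].
- by exists 1; rewrite ehr_one // ncomp_one mulr1.
- have /factor_theorem[q eq] : root (ehr (isoclass P)) 0.
    by rewrite /root ehr0 // isoclass_eq1 eqn0Ngt A0.
  by exists q; rewrite ncomp_qrep ncomp_connected // {1}eq subr0.
- exists (q * r); rewrite ehr_mul // eq er ncomp_mul exprD.
  by rewrite mulrACA.
Qed.

(** The values of [alpha_str]: see [alphaE]. *)
Let low (c : qp) : K := (ehr c)`_(ncomp (qrep c)).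

Lemma low_one : low mone = 1.
Proof. by rewrite /low ncomp_one ehr_one // coefC. Qed.

Lemma low_mul c d : low (mmul c d) = low c * low d.
Proof.
rewrite /low ncomp_mul ehr_mul //.
have [q ->] := ehr_factor c; have [r ->] := ehr_factor d.
by rewrite mulrACA -exprD !coefMXn !ltnn !subnn -!horner_coef0 hornerM.
Qed.

(** [ehr_P] is constant for [P] empty and divisible by [X^2] when [P] has two
    components. *)
Lemma ehr_coef1 (A : finType) (P : quasiPoset A) :
  (ehr (isoclass P))`_1 = (ncomp P == 1%N)%:R * low (isoclass P).
Proof.
rewrite /low ncomp_qrep; case: eqP => [->|n1]; first by rewrite mul1r.
rewrite mul0r; have [A0|A0] := posnP #|A|.
  by rewrite isoclass_empty // ehr_one // coefC.
have [q ->] := ehr_factor (isoclass P).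
rewrite ncomp_qrep coefMXn ltn_neqAle (cl_gt0 (components P) A0) andbT.
by rewrite eq_sym (introN eqP n1).
Qed.

(** The classes of [P / E] are those of [E], so a fibre of [g] that is a single
    class of [P / E] is a class of [E], and is connected in [P]. *)
Lemma kernel_compatible (A : finType) (P E : quasiPoset A) m
    (g : {ffun A -> 'I_m}) :
  is_equiv E -> compatible E P -> g \in monotone (contract P E) m ->
  (forall i, cl (restrict (contract P E) (fibre g i)) = 1%N) ->
  E = kernel g /\ forall i, ncomp (restrict P (fibre g i)) = 1%N.
Proof.
move=> /is_equivP Es /compatibleP[Ec Esim] /monotoneP gm c1.
have EK : E = kernel g.
  apply: quasiPoset_ext => x y; rewrite le_kernel; apply/idP/eqP=> [xy|e].
    by apply/val_inj/eqP; rewrite eqn_leq !gm ?contract_equiv // Es.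
  have /cl1P[_ tot] := introT eqP (c1 (g y)).
  have xf : x \in fibre g (g y) by rewrite in_fibre e.
  have yf : y \in fibre g (g y) by rewrite in_fibre.
  have := tot (Sub x xf) (Sub y yf); have := tot (Sub y yf) (Sub x xf).
  by rewrite !le_restrict -Esim /sim => /= -> ->.
split=> // i; apply/eqP/ncomp1P; have /cl1P[f0 _] := introT eqP (c1 i).
split=> //; move: (f0); rewrite card_sig => /card_gt0P[x].
rewrite in_fibre => /eqP xi; have := Ec x.
by congr (connected (restrict P _)); apply/setP=> y; rewrite in_fibre inE EK le_kernel xi eq_sym.
Qed.

Lemma compatible_kernel (A : finType) (P : quasiPoset A) m
    (g : {ffun A -> 'I_m}) :
  g \in monotone P m -> (forall i, ncomp (restrict P (fibre g i)) = 1%N) ->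
  [/\ is_equiv (kernel g), compatible (kernel g) P,
      g \in monotone (contract P (kernel g)) m
    & forall i, cl (restrict (contract P (kernel g)) (fibre g i)) = 1%N].
Proof.
move=> /monotoneP gm n1.
have con x y : le (contract P (kernel g)) x y -> (g x <= g y)%N.
  move: x y; apply: (contract_ind (R := fun x y => (g x <= g y)%N)) => //.
  - by move=> y x z; apply: leq_trans.
  - by move=> x y; rewrite le_kernel => /eqP->.
split.
- by apply/is_equivP=> x y; rewrite !le_kernel eq_sym.
- apply/compatibleP; split=> [x|x y].
    have /ncomp1P[_] := introT eqP (n1 (g x)).
    congr (connected (restrict P _)); apply/setP=> y.
    by rewrite in_fibre inE le_kernel eq_sym.
  rewrite le_kernel; apply/andP/eqP=> [[/con xy /con yx]|e].
    by apply/val_inj/eqP; rewrite eqn_leq xy.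
  by split; apply: contract_equiv; rewrite le_kernel e.
- by apply/monotoneP.
- move=> i; have /ncomp1P[f0 _] := introT eqP (n1 i).
  apply/eqP/cl1P; split=> // x y; rewrite le_restrict; apply: contract_equiv.
  have := valP x; have := valP y; rewrite /= !in_fibre le_kernel.
  by move=> /eqP-> /eqP->.
Qed.

Lemma prod_natr_bool (I : finType) (b : I -> bool) :
  \prod_i (b i)%:R = ([forall i, b i])%:R :> K.
Proof.
case: (boolP [forall i, b i]) => [/forallP h|].
  by rewrite big1 // => i _; rewrite h.
by rewrite negb_forall => /existsP[i /negbTE bi]; rewrite (bigD1 i) //= bi mul0r.
Qed.

(** By [hopf_coef], [m!] times the coefficient of index [m] is on both sides a
    sum over monotone maps [g]. On the left only the maps with nonempty
    connected fibres contribute; on the right, a map on [P / E] contributes if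
    each of its fibres is one class, that is if [E] is its kernel. The two
    conditions agree by [kernel_compatible] and [compatible_kernel]. *)
Lemma ehr_phi0 c :
  ehr c = \sum_(E : quasiPoset _ | is_equiv E && compatible E (qrep c))
    low (isoclass (inter (qrep c) E)) *: phi0 K << isoclass (contract (qrep c) E) >>.
Proof.
apply/polyP=> m; set P := qrep c.
have m0 : m`!%:R != 0 :> K by rewrite ((pcharf0P K).1 char0) -lt0n fact_gt0.
apply: (mulIf m0); rewrite !mulr_natr coef_sum -sumrMnl.
under eq_bigr => E _ do rewrite coefZ -mulrnAr (hopf_coef char0 (phi0_hopf char0)).
rewrite -{1}[c]isoclass_qrep -/P -ehr_strU (hopf_coef char0 (ehr_hopf char0)).
rewrite /fibre_sum; under [RHS]eq_bigr => E _ do rewrite mulr_sumr.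
rewrite (exchange_big_dep (mem (monotone P m))) /=; last first.
  move=> E g _ /monotoneP gm; apply/monotoneP=> i j ij.
  by apply: gm; apply: contract_le.
apply: eq_bigr => g gm.
under eq_bigr => i _ do rewrite ehr_strU ehr_coef1.
rewrite big_split prod_natr_bool (prod_fibres low_one low_mul) /=.
under [RHS]eq_bigr => E _.
  under eq_bigr => i _ do rewrite (phi0_coef1 char0).
  rewrite prod_natr_bool; over.
case: (boolP [forall i, _]) => [/forallP n1|nn1].
  have [Ke Kc Km c1] := compatible_kernel gm (fun i => eqP (n1 i)).
  rewrite (bigD1 (kernel g)) /= ?Ke ?Kc // big1 ?addr0.
    by rewrite mul1r (introT forallP) ?mulr1 // => i; apply/eqP.
  move=> E /andP[/andP[/andP[Ee Ec] Em] ne].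
  case: (boolP [forall i, _]) => [/forallP h|]; last by rewrite mulr0.
  have [eK _] := kernel_compatible Ee Ec Em (fun i => eqP (h i)).
  by rewrite eK eqxx in ne.
rewrite mul0r big1 // => E /andP[/andP[Ee Ec] Em].
case: (boolP [forall i, _]) => [/forallP h|]; last by rewrite mulr0.
have [_ n1] := kernel_compatible Ee Ec Em (fun i => eqP (h i)).
by case/negP: nn1; apply/forallP=> i; apply/eqP.
Qed.

Lemma act_basis (phi : Hqp K -> {poly K}) (l : Hqp K -> K^o) c :
  act phi l << c >> =
  \sum_(E : quasiPoset _ | is_equiv E && compatible E (qrep c))
    l << isoclass (inter (qrep c) E) >> *: phi << isoclass (contract (qrep c) E) >>.
Proof. exact: linext_delta. Qed.

Lemma conv_basis (l m : Hqp K -> K^o) c :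
  conv l m << c >> =
  \sum_(E : quasiPoset _ | is_equiv E && compatible E (qrep c))
    l << isoclass (contract (qrep c) E) >> * m << isoclass (inter (qrep c) E) >>.
Proof. exact: linext_delta. Qed.

Lemma act_linear (phi : Hqp K -> {poly K}) (l : Hqp K -> K^o) : linear (act phi l).
Proof. exact: linear_comp (@delta_linear K) (linext_linear _). Qed.

Lemma conv_linear (l m : Hqp K -> K^o) : linear (conv l m : Hqp K -> K^o).
Proof. exact: linear_comp (@delta_linear K) (linext_linear _). Qed.

Lemma alpha_spec :
  is_char (alpha_str K) /\ ehr_str K =1 act (phi0 K) (alpha_str K).
Proof.
pose Q (l : Hqp K -> K^o) := is_char l /\ ehr_str K =1 act (phi0 K) l.
suff h : exists l, Q l by exact (epsilon_spec (inhabits (fun=> 0)) Q h).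
exists (linext (low : qp -> K^o)); split.
  by apply: alg_mor_linext; [exact: low_one|exact: low_mul].
apply: linear_malg_ext; [exact: linext_linear|exact: act_linear|move=> c].
rewrite ehr_strU act_basis ehr_phi0; apply: eq_bigr => E _.
by rewrite linextU.
Qed.

Lemma alpha_char : is_char (alpha_str K). Proof. by case: alpha_spec. Qed.

Lemma ehr_alpha c :
  ehr c = \sum_(E : quasiPoset _ | is_equiv E && compatible E (qrep c))
    alpha_str K << isoclass (inter (qrep c) E) >>
      *: phi0 K << isoclass (contract (qrep c) E) >>.
Proof. by rewrite -act_basis -ehr_strU; case: alpha_spec. Qed.

(** For connected [P], only the indiscrete [E] contributes to the linear
    coefficient of [phi0 <- alpha]. *)
Lemma alpha_connected c : ncomp (qrep c) = 1%N -> alpha_str K << c >> = (ehr c)`_1.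
Proof.
move=> n1; have /ncomp1P[A0 con] := introT eqP n1.
rewrite ehr_alpha coef_sum; set P := qrep c.
pose I := indiscrete 'I_(tag (repr c : qp_rep)).
have ItotP x y : le I x y by rewrite le_mkQP.
have IP : compatible I P.
  apply/compatibleP; split=> x => [|y]; last by rewrite /sim !contract_equiv ?ItotP.
  have -> : [set y | le I x y] = setT by apply/setP=> y; rewrite !inE ItotP.
  apply/connected_restrictP=> U hU i j _ _.
  move/connected_componentsP: con => /(_ i j)/componentsP; apply; apply/clopenP=> a b.
  by apply: hU; rewrite inE.
have Ie : is_equiv I by apply/is_equivP=> x y _; apply: ItotP.
rewrite (bigD1 I) ?Ie //= big1 ?addr0 => [|E /andP[/andP[_ /compatibleP[_ Esim]] ne]].
  rewrite coefZ (phi0_coef1 char0) (introT (cl1P _)); last first.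
    by split=> // x y; apply: contract_equiv.
  rewrite mulr1 (_ : inter P I = P) ?isoclass_qrep //.
  by apply: quasiPoset_ext => x y; rewrite le_inter ItotP andbT.
rewrite coefZ (phi0_coef1 char0); case: cl1P; rewrite ?mulr0 // => -[_ tot].
case/eqP: ne; apply: quasiPoset_ext => x y.
by rewrite ItotP -Esim /sim !tot.
Qed.

Lemma alphaE c : alpha_str K << c >> = low c.
Proof.
elim/connected_ind: c => [|A P A0 con|c d IHc IHd].
- by rewrite low_one (char_one alpha_char).
- have n1 : ncomp (qrep (isoclass P)) = 1%N by rewrite ncomp_qrep ncomp_connected.
  by rewrite alpha_connected // /low n1.
- by rewrite low_mul (char_mul alpha_char) IHc IHd.
Qed.

(** The value at [1] of [ehr_str = phi0 <- alpha_str]. *)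
Lemma conv_lambda_alpha : conv (lambda K) (alpha_str K) =1 @eps' K.
Proof.
apply: linear_malg_ext => [||c]; [exact: conv_linear|exact: linext_linear|].
rewrite /eps' linextU conv_basis; transitivity (ehr c).[1]; last exact: ehr1.
rewrite ehr_alpha horner_sum.
by apply: eq_bigr => E _; rewrite hornerZ phi0_1 // mulrC.
Qed.

(** The coefficient of [X^(ncomp P)] in [phi0 = ehr_str <- lambda]; contraction
    by [E <| P] preserves the number of components. *)
Lemma conv_alpha_lambda : conv (alpha_str K) (lambda K) =1 @eps' K.
Proof.
apply: linear_malg_ext => [||c]; [exact: conv_linear|exact: linext_linear|].
rewrite /eps' linextU conv_basis.
transitivity ((phi0 K << c >>)`_(ncomp (qrep c))).
  rewrite phi0_ehr // coef_sum; apply: eq_bigr => E /andP[Ee Ec].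
  by rewrite alphaE /low ncomp_qrep ncomp_contract // coefZ mulrC.
rewrite phi0U // coefZ coefXn (ncomp_leqif_cl c).2.
case: (boolP (discrete _)) => [/lambda_discrete->//|_]; last by rewrite mulr0.
by rewrite mulr1.
Qed.

End Alpha.

Theorem theorem37 (K : fieldType) (char0 : [pchar K] =i pred0) :
  [/\ hopf_mor (ehr_str K),
      bialg_mor (ehr_str K),
      (forall psi : Hqp K -> {poly K},
         hopf_mor psi -> bialg_mor psi -> psi =1 ehr_str K)
    & char_inverse (lambda K) (alpha_str K)].
Proof.
split; [exact: ehr_hopf|exact: ehr_bialg|exact: ehr_unique|].
split; [exact: lambda_char|exact: alpha_char|exact: conv_lambda_alpha|].
exact: conv_alpha_lambda.
Qed.
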